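(* Let $(r_n)_{n\ge 1}$ be a sequence of radii with $r_n \geq 4^{n/5}$ for all $n$. Then $(r_n)$ is undercooked, i.e. there is a constant $C>0$ independent of $n$ such that $\mathrm{Fav}_{\sigma^{(n)}}(\mathcal{K}_n)\geq C\,\frac{\log n}{n}$ for all $n\ge 2$, where $\sigma^{(n)}$ is the map $\sigma$ built from $f_{r_n}$ as described in the context.
   Context: Middle-half Cantor set: $\mathcal{C}_0=[0,1]$ and $\mathcal{C}_{n+1}$ is obtained from $\mathcal{C}_n$ by replacing each of its intervals by the first and last quarters of that interval (removing the middle half). Thus $\mathcal{C}_n$ is a union of $2^n$ intervals of length $4^{-n}$, and $\mathcal{K}_n:=\mathcal{C}_n\times\mathcal{C}_n\subset\mathbb{R}^2=\mathbb{C}$ is a union of $4^n$ closed squares of side $4^{-n}$. For an angle $\theta$, $\mathrm{Proj}_\theta$ denotes orthogonal projection onto the line through the origin in direction $e^{i\theta}$, and $|\cdot|$ denotes one-dimensional Lebesgue measure on that line. For a map $T:\mathbb{C}\times S^1\to\mathbb{C}$ write $T_\theta(z):=T(z,e^{i\theta})$ and define, for $E\subset\mathbb{C}$, $\mathrm{Fav}_T(E):=\frac{1}{2\pi}\int_0^{2\pi}|\mathrm{Proj}_\theta(T_\theta(E))|\,d\theta$. For $r>0$ define $f_r(y):=r-\sqrt{r^2-y^2}$ if $|y|\le 2$ and $f_r(y):=r-\sqrt{r^2-4}$ otherwise. Let $\sigma_0(x,y):=(x-f_r(y),y)$, let $R_\theta$ be clockwise rotation of the plane by the angle $\theta$, and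 set $\sigma_\theta:=R_{-\theta}\circ\sigma_0\circ R_\theta$; this defines $\sigma:\mathbb{C}\times S^1\to\mathbb{C}$ by $\sigma(z,e^{i\theta})=\sigma_\theta(z)$. A sequence of maps $T_n:\mathbb{C}\times S^1\to\mathbb{C}$ is an undercooking of the plane if there is $C>0$ independent of $n$ with $\mathrm{Fav}_{T_n}(\mathcal{K}_n)\ge C\frac{\log n}{n}$; a sequence $(r_n)$ is undercooked if the maps $\sigma$ built from $f_{r_n}$ form an undercooking. *)

(* Defs.v *)
From HB Require Import structures.
From mathcomp Require Import all_boot all_order all_algebra.
From mathcomp Require Import all_classical all_reals all_analysis.
Set Implicit Arguments. Unset Strict Implicit. Unset Printing Implicit Defensive.
Import Order.TTheory GRing.Theory Num.Theory.
Local Open Scope classical_set_scope.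
Local Open Scope ring_scope.

Section Defs.
Variable R : realType.

(* Left endpoints of the 2^n intervals of length 4^-n making up C_n:
   A_0 = {0}; each interval [a, a + 4^-n] is replaced by its first quarter
   [a, a + 4^-(n+1)] and its last quarter [a + 3*4^-(n+1), a + 4^-n]. *)
Fixpoint cantor_left (n : nat) : set R :=
  match n with
  | O => [set 0]
  | S m => [set b | exists2 a, cantor_left m a &
              (b = a \/ b = a + 3 * (4 ^- m.+1))]
  end.

Definition cantorC (n : nat) : set R :=
  \bigcup_(a in cantor_left n) `[a, a + 4 ^- n]%classic.

Definition cantorK (n : nat) : set (R * R) :=
  [set z | cantorC n z.1 /\ cantorC n z.2].

(* Orthogonal projection onto the line through 0 in direction e^{i theta},
   identified isometrically with R via the coordinate <z, e^{i theta}>. *)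
Definition proj (theta : R) (z : R * R) : R :=
  z.1 * cos theta + z.2 * sin theta.

(* Favard length of E with respect to a family T_theta (T_theta(z) = T(z, e^{i theta})):
   (1/2pi) int_0^{2pi} |Proj_theta(T_theta(E))| dtheta, with |.| Lebesgue (outer) measure. *)
Definition Fav (T : R -> R * R -> R * R) (E : set (R * R)) : \bar R :=
  (((2 * pi)^-1)%:E *
   \int[lebesgue_measure]_(theta in `[0%R, (2 * pi)%R]%classic)
       lebesgue_measure (proj theta @` (T theta @` E)))%E.

Definition f_r (r y : R) : R :=
  if `|y| <= 2 then r - Num.sqrt (r ^+ 2 - y ^+ 2) else r - Num.sqrt (r ^+ 2 - 4).

Definition sigma0 (r : R) (z : R * R) : R * R := (z.1 - f_r r z.2, z.2).

Definition rotcw (theta : R) (z : R * R) : R * R :=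
  (z.1 * cos theta + z.2 * sin theta, - z.1 * sin theta + z.2 * cos theta).

Definition sigma (r : R) (theta : R) (z : R * R) : R * R :=
  rotcw (- theta) (sigma0 r (rotcw theta z)).

End Defs.

(* Main.v *)
(* Second moment method of Bateman and Volberg. Write the angle as theta0 + s,
   where theta0 is the direction of slope 2. For s of order 4^-j, two squares
   whose indices first differ in a digit of weight 4^l can only collide after
   projection if their indices, as integers, are within O(4^(l-j)) of each other
   although they lie in different blocks of length 4^l; both indices must then be
   close to a block boundary, so only a fraction 4^(-2j) of the pairs is left.
   Summed over l and over the angles of the ring, the number of collisions is
   O(n 4^(2n-2j)) as long as 4^j <= n, hence each ring contributes a constant
   times 1/n to the Favard length, and there are about log n rings.

   The curvature is handled by elementary algebra: up to the shift by r, the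
   curved projection p of z is the abscissa of the centre of the circle of radius
   r through z, so p^2 - 2 p x + |z|^2 = r^2 where x is the linear projection.
   Subtracting two such equations shows that the curvature perturbs the slope
   between two points by O(1/r), and r is much larger than n. *)
Require Import Defs.
From HB Require Import structures.
From mathcomp Require Import all_boot all_order all_algebra.
From mathcomp Require Import all_classical all_reals all_analysis.
From mathcomp Require Import measurable_realfun.
From mathcomp Require Import ring lra zify.
Import Order.TTheory GRing.Theory Num.Theory.
Import numFieldNormedType.Exports Defs.
Local Open Scope classical_set_scope.
Local Open Scope ring_scope.

(** * Lower bounds for measures and integrals *)

Section MeasureBounds.
Variable R : realType.
Implicit Types (A D : set R).

(** On arbitrary sets [lebesgue_measure] is an outer measure, hence monotone; this handles projected
    images without showing them measurable. *)
Lemma le_lebesgue_measure A D : A `<=` D ->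
  (lebesgue_measure A <= lebesgue_measure D)%E.
Proof. by move=> AD; exact: le_mu_ext. Qed.

Definition grid_cell (d : R) (v : int) : set R :=
  `[v%:~R * d, (v%:~R + 1) * d[%classic.

Lemma grid_cell_disj (d : R) (v w : int) (x : R) : 0 < d ->
  grid_cell d v x -> grid_cell d w x -> v = w.
Proof.
move=> d0; rewrite /grid_cell/= !in_itv/= => /andP[v1 v2] /andP[w1 w2].
have vw : v%:~R * d < (w%:~R + 1) * d by exact: le_lt_trans w2.
have wv : w%:~R * d < (v%:~R + 1) * d by exact: le_lt_trans v2.
move: vw wv; rewrite !ltr_pM2r// -!(intrD _ _ 1) !ltr_int; lia.
Qed.

Lemma lebesgue_measure_grid_cells (d : R) (vs : seq int) A : 0 < d ->
  uniq vs -> (forall v, v \in vs -> grid_cell d v `<=` A) ->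
  (((size vs)%:R * d)%:E <= lebesgue_measure A)%E.
Proof.
move=> d0 uvs vsA.
pose U (s : seq int) := \big[setU/set0]_(v <- s) grid_cell d v.
have inU s x : U s x -> exists2 v, v \in s & grid_cell d v x.
  elim: s => [|v s ih]; rewrite /U ?big_nil ?big_cons// => -[vx|/ih[w ws wx]].
    by exists v; rewrite ?mem_head.
  by exists w => //; rewrite in_cons ws orbT.
have mU s : measurable (U s) by apply: bigsetU_measurable => v _; exact: measurable_itv.
apply: (@le_trans _ _ (lebesgue_measure (U vs))); last first.
  by apply: le_lebesgue_measure => x /inU[v /vsA]; exact.
rewrite le_eqVlt; apply/orP; left; apply/eqP.
elim: vs uvs {vsA} => [|v s ih] /=.
  by rewrite /U big_nil measure0 mul0r.
move=> /andP[vs us]; rewrite /U big_cons measureU//.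
- rewrite -natr1 mulrDl mul1r addrC EFinD; congr (_ + _)%E; last exact: ih.
  rewrite [RHS]lebesgue_measure_itv/= lte_fin ltr_pM2r// ltrDl ltr01.
  by rewrite -EFinD; congr (_%:E); lra.
- exact: measurable_itv.
- exact: mU.
- apply/seteqP; split => // x [vx /inU[w ws wx]].
  by rewrite (grid_cell_disj _ _ _ _ d0 vx wx) ws in vs.
Qed.

Import HBNNSimple.

(* The step function is a simple function below [G], hence a competitor in the
   supremum that defines the integral, whether or not [G] is measurable. *)
Lemma integral_ge_step (d : measure_display) (T : measurableType d)
    (mu : {measure set T -> \bar R}) (D : set T) (G : T -> \bar R) (K : nat)
    (c : nat -> R) (F : nat -> set T) :
  measurable D -> (forall x, D x -> (0 <= G x)%E) ->
  (forall i, measurable (F i)) -> (forall i, 0 <= c i) ->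
  (forall i, (i < K)%N -> F i `<=` D) ->
  (forall i j x, F i x -> F j x -> i = j) ->
  (forall i x, (i < K)%N -> F i x -> ((c i)%:E <= G x)%E) ->
  (\sum_(i < K) (c i)%:E * mu (F i) <=
   \int[mu]_(x in D) G x)%E.
Proof.
move=> mD G0 mF c0 FD Fdisj cG.
pose g i : {nnsfun T >-> R} := scale_nnsfun (indic_nnsfun R (mF i)) (c0 i).
pose h := sum_nnsfun g K.
have hE x : h x = \sum_(i < K) c i * \1_(F i) x by rewrite /h sum_nnsfunE.
have -> : (\sum_(i < K) (c i)%:E * mu (F i) =
    \int[mu]_x (h x)%:E)%E.
  transitivity (\int[mu]_x
      (\sum_(i < K) (c i)%:E * (\1_(F i) x)%:E))%E; last first.
    by apply: eq_integral => x _; rewrite hE -sumEFin; under [RHS]eq_bigr do rewrite EFinM.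
  rewrite ge0_integral_sum//; last 2 first.
  - move=> i; apply: emeasurable_funM => //.
    exact/measurable_EFinP/measurable_indic.
  - by move=> i x _; rewrite -EFinM lee_fin mulr_ge0.
  apply: eq_bigr => i _; rewrite ge0_integralZl//.
  - by rewrite integral_indic//; rewrite setIT.
  - exact/measurable_EFinP/measurable_indic.
  - by rewrite lee_fin.
rewrite (integral_nnsfun mu measurableT h) ge0_integralE//.
apply: ereal_sup_ubound; exists h; last by rewrite patch_setT.
move=> x /=; rewrite /patch; have [[i Fi]|nF] := pselect (exists i : 'I_K, F i x); last first.
  rewrite hE big1; last first.
    move=> i _; rewrite indicE memNset ?mulr0// => Fi; apply: nF; by exists i.
  by case: ifPn => //; rewrite inE => /G0.
rewrite mem_set; last by exact: (FD i).
rewrite hE (bigD1 i)//= indicE mem_set// mulr1 big1 ?addr0; first exact: cG.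
move=> j ji; rewrite indicE memNset ?mulr0// => Fj; move/eqP: ji; apply.
by apply: val_inj; exact: Fdisj Fj Fi.
Qed.

End MeasureBounds.

(** * Base-4 indexing of the squares *)

Section Digits.
Local Open Scope nat_scope.

(* The base-4 digit a + 2b of the index m stands for the pair (a, b) of binary
   choices of first or last quarter in the two coordinates; the corner of the
   square indexed by m is (digx n m, digy n m) / 4^n. *)
Fixpoint digx (n m : nat) : nat :=
  if n is k.+1 then 4 * digx k (m %/ 4) + 3 * (m %% 2) else 0.

Fixpoint digy (n m : nat) : nat :=
  if n is k.+1 then 4 * digy k (m %/ 4) + 3 * ((m %% 4) %/ 2) else 0.

(** A digit [a + 2b] contributes [3a] to [digx] and [3b] to [digy], so the identity holds digit by
    digit. *)
Lemma digx_digy n m : m < 4 ^ n -> digx n m + 2 * digy n m = 3 * m.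
Proof.
elim: n m => [|n ih] m /=; first by rewrite expn0; case: m.
by rewrite expnS => mn; have := ih (m %/ 4); lia.
Qed.

Lemma digx_lt n m : digx n m < 4 ^ n.
Proof. by elim: n m => [|n ih] m //=; rewrite expnS; have := ih (m %/ 4); lia. Qed.

Lemma digy_lt n m : digy n m < 4 ^ n.
Proof. by elim: n m => [|n ih] m //=; rewrite expnS; have := ih (m %/ 4); lia. Qed.

(** Indices in one block of length [4 ^ l] share all digits of weight [4 ^ l] or more; the lower
    digits contribute less than [4 ^ l] to each coordinate. *)
Lemma dig_block n l m m' : m %/ 4 ^ l = m' %/ 4 ^ l ->
  digx n m < digx n m' + 4 ^ l /\ digy n m < digy n m' + 4 ^ l.
Proof.
elim: l n m m' => [|l ih] n m m'.
  by rewrite expn0 !divn1 => ->; rewrite !addn1 !ltnSn.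
case: n => [|n] /=; first by rewrite !add0n expn_gt0.
rewrite expnS !divnMA => /(ih n) []; lia.
Qed.

(** At the highest differing digit one binary choice differs and moves its coordinate by
    [3 * 4 ^ l]; the lower digits give back less than [4 ^ l]. *)
Lemma dig_sep n l m m' : l < n ->
  m %/ 4 ^ l.+1 = m' %/ 4 ^ l.+1 -> m %/ 4 ^ l <> m' %/ 4 ^ l ->
  [\/ digx n m + 2 * 4 ^ l < digx n m', digx n m' + 2 * 4 ^ l < digx n m,
      digy n m + 2 * 4 ^ l < digy n m' | digy n m' + 2 * 4 ^ l < digy n m].
Proof.
elim: l n m m' => [|l ih] [|n] // m m' ln.
  rewrite expn1 expn0 !divn1 muln1 => e ne /=; rewrite e.
  have : m %% 4 <> m' %% 4.
    by move=> f; apply: ne; rewrite (divn_eq m 4) (divn_eq m' 4) e f.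
  have : m %% 4 < 4 by rewrite ltn_mod.
  have : m' %% 4 < 4 by rewrite ltn_mod.
  have -> : m %% 2 = (m %% 4) %% 2 by lia.
  have -> : m' %% 2 = (m' %% 4) %% 2 by lia.
  case: (m %% 4) => [|[|[|[|//]]]]; case: (m' %% 4) => [|[|[|[|//]]]] //= _ _ _; 
   by [apply: Or41; lia|apply: Or42; lia|apply: Or43; lia|apply: Or44; lia].
move=> e ne /=; have [||h|h|h|h] := ih n (m %/ 4) (m' %/ 4) ln.
- by rewrite -!divnMA -expnS.
- by rewrite -!divnMA -expnS.
all: rewrite expnS;
  by [apply: Or41; lia|apply: Or42; lia|apply: Or43; lia|apply: Or44; lia].
Qed.

Lemma ex_level n m m' : m < 4 ^ n -> m' < 4 ^ n -> m <> m' ->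
  exists l, [/\ l < n, m %/ 4 ^ l.+1 = m' %/ 4 ^ l.+1 &
                m %/ 4 ^ l <> m' %/ 4 ^ l].
Proof.
elim: n m m' => [|n ih] m m'; first by rewrite expn0; lia.
rewrite expnS => mn m'n mm'.
have [e|ne] := eqVneq (m %/ 4) (m' %/ 4).
  by exists 0; rewrite expn1 expn0 !divn1.
have [|||l [ln e f]] := ih (m %/ 4) (m' %/ 4); [lia|lia|exact/eqP|].
by exists l.+1; split => //; rewrite expnS !divnMA.
Qed.

End Digits.

(** * Counting pairs of indices that can collide *)

Section Counting.
Local Open Scope nat_scope.

Lemma sum_interval N (b : nat -> bool) a len :
  (forall i, i < N -> b i -> a <= i < a + len) ->
  \sum_(i < N) b i <= len.
Proof.
move=> bN; rewrite -(big_mkord xpredT (fun i => nat_of_bool (b i))).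

have -> : \sum_(0 <= i < N) b i = size [seq i <- iota 0 N | b i].
  by rewrite size_filter -sum1_count /index_iota subn0 [RHS]big_mkcond.
rewrite -[X in _ <= X](size_iota a); apply: uniq_leq_size.
  by rewrite filter_uniq// iota_uniq.
move=> i; rewrite mem_filter !mem_iota add0n => /andP[bi iN]; exact: bN.
Qed.

Lemma sum_modn B q (f : nat -> nat) :
  \sum_(m < B * q) f (m %% q) = B * \sum_(t < q) f t.
Proof.
rewrite -(big_mkord xpredT (fun m => f (m %% q))) -(big_mkord xpredT f).
elim: B => [|B ih]; first by rewrite !mul0n big_nil.
rewrite mulSn addnC (big_cat_nat _ (n := B * q)) ?leq_addr//= ih mulSn addnC.
congr (_ + _); rewrite -{1}[B * q]add0n (addnC (B * q)) big_addn.
rewrite addnK; apply: eq_big_nat => i /= iq.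
by rewrite addnC modnMDl modn_small.
Qed.

Definition nearby (L m m' : nat) : bool := (m <= m' + L) && (m' <= m + L).

Lemma sum_nearby N L : \sum_(m < N) \sum_(m' < N) nearby L m m' <= N * (2 * L + 1).
Proof.
rewrite -[N in N * _]card_ord -sum_nat_const; apply: leq_sum => m _.
by apply: (sum_interval _ _ (m - L)) => i _; rewrite /nearby; lia.
Qed.

(** Nearby indices in different blocks have a block boundary between them, so [m] lies within [L] of
    an end of its block. This leaves at most [2 L] residues modulo [q], each with at most [2 L + 1]
    partners. *)
Lemma sum_nearby_block N B q L : 0 < q -> N = B * q ->
  \sum_(m < N) \sum_(m' < N)
     ((m %/ q != m' %/ q) && nearby L m m') <= B * (2 * L * (2 * L + 1)).
Proof.
move=> q0 ->.
apply: (@leq_trans (\sum_(m < B * q)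
    ((q <= m %% q + L) + (m %% q < L)) * (2 * L + 1))).
  apply: leq_sum => m _.
  have [h|h] := boolP ((q <= m %% q + L) || (m %% q < L)); last first.
    rewrite big1// => m' _; apply/eqP; rewrite eqb0; apply/negP.
    rewrite /nearby => /andP[/eqP ne /andP[h1 h2]].
    move: h; rewrite negb_or -leqNgt -ltnNge => /andP[h3 h4].
    have em := divn_eq m q; have em' := divn_eq m' q.
    have lm := ltn_pmod m q0; have lm' := ltn_pmod m' q0.
    have [lt|lt|//] := ltngtP (m %/ q) (m' %/ q); nia.
  apply: (@leq_trans (2 * L + 1)); last by move: h; do 2 case: (_ <= _); lia.
  apply: (sum_interval _ (fun m' => (m %/ q != m' %/ q) && nearby L m m') (m - L)).
  by move=> i _; rewrite /nearby => /andP[_]; lia.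
rewrite (sum_modn B q (fun t => ((q <= t + L) + (t < L)) * (2 * L + 1))).
rewrite leq_mul2l; apply/orP; right; rewrite -big_distrl/= leq_mul2r; apply/orP; right.
rewrite big_split/= mul2n -addnn leq_add//.
  by apply: (sum_interval _ (fun t => q <= t + L) (q - L)) => i iq; lia.
by apply: (sum_interval _ (fun t => t < L) 0) => i iq; lia.
Qed.

(* [coll i m m'] stands for: at the [i]-th angle the squares [m] and [m'] have
   their projections in the same cell. *)
Lemma sum_collisions (n j D K : nat) (coll : nat -> nat -> nat -> bool) :
  (j <= n) ->
  (forall l m m' i, l < n -> m < 4 ^ n -> m' < 4 ^ n ->
     m %/ 4 ^ l.+1 = m' %/ 4 ^ l.+1 -> m %/ 4 ^ l <> m' %/ 4 ^ l ->
     i < K -> coll i m m' ->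
     nearby (if j <= l.+1 then 3 * 4 ^ (l.+1 - j) + 1 else 4) m m') ->
  (forall l m m' i i', l < n -> m < 4 ^ n -> m' < 4 ^ n ->
     m %/ 4 ^ l.+1 = m' %/ 4 ^ l.+1 -> m %/ 4 ^ l <> m' %/ 4 ^ l ->
     i < K -> i' < K -> coll i m m' -> coll i' m m' ->
     i <= i' + D * 4 ^ (n - l)) ->
  \sum_(i < K) \sum_(m < 4 ^ n) \sum_(m' < 4 ^ n) coll i m m' <=
    9 * 4 ^ n * K + n * (1152 * (2 * D + 1)) * 4 ^ (2 * (n - j)).
Proof.
move=> jn H1 H2.
pose L l := 3 * 4 ^ (l.+1 - j) + 1.
pose w l m m' := (j <= l.+1) && ((m %/ 4 ^ l != m' %/ 4 ^ l) && nearby (L l) m m').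
(* A diagonal pair, or one of level [l] with [l.+1 < j], is charged for all [K] angles but has
   nearby indices. Any other pair collides only in a window around one collision angle, by the
   second hypothesis used in both directions. *)
have key (m m' : 'I_(4 ^ n)) : \sum_(i < K) coll i m m' <=
    K * nearby 4 m m' + \sum_(l < n) w l m m' * ((2 * D + 1) * 4 ^ (n - l)).
  have cK : \sum_(i < K) coll i m m' <= K by apply: (sum_interval _ (fun i => coll i m m') 0).
  have [e|ne] := eqVneq (m : nat) m'.
    have -> : nearby 4 m m' = true by rewrite /nearby e leq_addr.
    by rewrite muln1 (leq_trans cK)// leq_addr.
  have [l [ln e f]] := ex_level n m m' (ltn_ord m) (ltn_ord m') (elimN eqP ne).
  have [[i ci]|nc] := pselect (exists i : 'I_K, coll i m m'); last first.
    rewrite big1// => i _; apply/eqP; rewrite eqb0; apply/negP => ci.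
    by apply: nc; exists i.
  have := H1 l m m' i ln (ltn_ord m) (ltn_ord m') e f (ltn_ord i) ci.
  case: ifPn => jl nm; last by rewrite nm muln1 (leq_trans cK)// leq_addr.
  apply: (leq_trans _ (leq_addl _ _)).
  rewrite (bigD1 (Ordinal ln))//= /w jl nm andbT (introN eqP f) mul1n.
  apply: (leq_trans _ (leq_addr _ _)).
  apply: (@leq_trans (2 * (D * 4 ^ (n - l)) + 1)).
    apply: (sum_interval _ (fun i => coll i m m') (i - D * 4 ^ (n - l))) => k kK ck.
    have := H2 l m m' i k ln (ltn_ord m) (ltn_ord m') e f (ltn_ord i) kK ci ck.
    have := H2 l m m' k i ln (ltn_ord m) (ltn_ord m') e f kK (ltn_ord i) ck ci.
    lia.
  have : 0 < 4 ^ (n - l) by rewrite expn_gt0.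
  by nia.
rewrite exchange_big/=; under eq_bigr do rewrite exchange_big/=.
apply: (leq_trans (leq_sum _ _)) => [m _|].
  by apply: leq_sum => m' _; exact: key.
under eq_bigr do rewrite big_split/=.
rewrite big_split/= leq_add//.
  under eq_bigr do rewrite -big_distrr/=.
  rewrite -big_distrr/= mulnC leq_mul2r (leq_trans (sum_nearby _ _)) ?orbT//.
  by rewrite mulnC.
under eq_bigr do rewrite exchange_big/=.
rewrite exchange_big/=.
apply: (@leq_trans (\sum_(l < n) 1152 * (2 * D + 1) * 4 ^ (2 * (n - j)))); last first.
  by rewrite sum_nat_const card_ord mulnA.
apply: leq_sum => l _.
under eq_bigr do rewrite -big_distrl/=.
rewrite -big_distrl/= /w.
have [jl|jl] := boolP (j <= l.+1); last by rewrite big1// => m _; rewrite big1.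
have ln := ltn_ord l.
have := sum_nearby_block (4 ^ n) (4 ^ (n - l)) (4 ^ l) (L l).
rewrite expn_gt0 -expnD subnK; last exact: ltnW.
move=> /(_ erefl erefl)/= h.
apply: (leq_trans (leq_mul h (leqnn _))); rewrite /L.
set b := 4 ^ (n - l); set e := 4 ^ (l.+1 - j); set X := 4 ^ (2 * (n - j)).
have e0 : 0 < e by rewrite expn_gt0.
(* The level [l] cancels between the number of blocks, the angle window and the squared width of the
   boundary layer, so all levels share one bound; [1152 = 72 * 16]. *)
have bX : b * b * (e * e) = 16 * X.
  rewrite /b /e /X -!expnD -[16]/(4 ^ 2) -expnD; congr (_ ^ _); lia.
have h1 : 2 * (3 * e + 1) * (2 * (3 * e + 1) + 1) <= 72 * (e * e) by nia.
apply: (@leq_trans (b * (72 * (e * e)) * ((2 * D + 1) * b))).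
  by rewrite leq_mul2r leq_mul2l h1 !orbT.
by apply/eq_leq; transitivity (72 * (2 * D + 1) * (b * b * (e * e))); [ring|rewrite bX; ring].
Qed.
End Counting.

(** Linearised Cauchy-Schwarz: with [a v] the size of the fibre over [v], sum
    [(1 - lam * a v)^2 >= 0] over the values. Being linear in the collision count, it can be summed
    over the angles with one [lam]. *)
Lemma size_undup_map_ge (R : realFieldType) (T : Type) (E : eqType)
    (s : seq T) (f : T -> E) (lam : R) :
  2 * lam * (size s)%:R - lam ^+ 2 * (\sum_(x <- s) \sum_(y <- s) (f x == f y))%:R
    <= (size (undup (map f s)))%:R.
Proof.
set t := map f s; pose a v := count_mem v t.
have sumE (g : E -> R) : \sum_(x <- s) g (f x) = \sum_(v <- undup t) (a v)%:R * g v.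
  rewrite -(big_map f xpredT g) -big_undup_iterop_count.
  by apply: eq_bigr => v _; rewrite mulr_natl /a Monoid.iteropE iter_addr_0.
have sizeE : (size s)%:R = \sum_(v <- undup t) (a v)%:R :> R.
  have := sumE (fun=> 1); under [RHS]eq_bigr do rewrite mulr1.
  by rewrite big_const_seq count_predT iter_addr addr0.
have pairE : (\sum_(x <- s) \sum_(y <- s) (f x == f y))%:R =
    \sum_(v <- undup t) (a v)%:R ^+ 2 :> R.
  have -> : (\sum_(x <- s) \sum_(y <- s) (f x == f y) = \sum_(x <- s) a (f x))%N.
    apply: eq_bigr => x _; rewrite /a /t count_map -sum1_count [RHS]big_mkcond/=.
    by apply: eq_bigr => y _; rewrite eq_sym; case: eqP.
  by rewrite natr_sum (sumE (fun v => (a v)%:R)); under [RHS]eq_bigr do rewrite expr2.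
have -> : (size (undup t))%:R = \sum_(v <- undup t) 1 :> R.
  by rewrite big_const_seq count_predT iter_addr addr0.
rewrite sizeE pairE !big_distrr/= -sumrB; apply: ler_sum => v _.
by rewrite -subr_ge0 (_ : _ - _ = (1 - lam * (a v)%:R) ^+ 2) ?sqr_ge0//; ring.
Qed.

(** * Corners of the Cantor squares *)

Section CantorCorners.
Variable R : realType.

(** Appending a lowest digit to the index is one subdivision step; [d] is abstract so that both
    coordinates are instances. *)
Lemma cantor_left_digits (n : nat) (d : nat -> nat -> nat) (c : nat -> nat) :
  (forall m, d 0 m = 0)%N -> (forall m, c m <= 1)%N ->
  (forall k m, d k.+1 m = 4 * d k (m %/ 4) + 3 * c m)%N ->
  forall m, cantor_left n (((d n m)%:R : R) / 4 ^+ n).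
Proof.
move=> d0 c1 dS; elim: n => [|n ih] m /=; first by rewrite d0 mul0r.
exists ((d n (m %/ 4)%N)%:R / 4 ^+ n); first exact: ih.
have n0 : (4 ^+ n : R) != 0 by rewrite expf_neq0// pnatr_eq0.
rewrite dS natrD !natrM !exprS; have := c1 m.
case: (c m) => [|[|//]] _; [left|right]; by field.
Qed.

Lemma cantor_left_digx (n m : nat) : cantor_left n ((digx n m)%:R / 4 ^+ n : R).
Proof.
apply: (cantor_left_digits n digx (fun m => m %% 2)%N) => // k.
by have := ltn_pmod k (isT : (0 < 2)%N).
Qed.

Lemma cantor_left_digy (n m : nat) : cantor_left n ((digy n m)%:R / 4 ^+ n : R).
Proof.
by apply: (cantor_left_digits n digy (fun m => (m %% 4) %/ 2)%N) => // k; lia.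
Qed.

Lemma cantorK_corner (n m : nat) (a b : R) :
  0 <= a <= 4 ^- n -> 0 <= b <= 4 ^- n ->
  cantorK n ((digx n m)%:R / 4 ^+ n + a, (digy n m)%:R / 4 ^+ n + b).
Proof.
move=> /andP[a0 a1] /andP[b0 b1]; split => /=.
  exists ((digx n m)%:R / 4 ^+ n); first exact: cantor_left_digx.
  by rewrite /= in_itv/= lerDl a0 lerD2l.
exists ((digy n m)%:R / 4 ^+ n); first exact: cantor_left_digy.
by rewrite /= in_itv/= lerDl b0 lerD2l.
Qed.

End CantorCorners.

(** * Trigonometric bounds and the direction of slope 2 *)

Section Trig.
Variable R : realType.
Implicit Types x a b s : R.

Lemma sin_mvt x : 0 <= x -> exists2 c, 0 <= c <= x & sin x = cos c * x.
Proof.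
move=> x0.
have [|c] := @MVT_segment R sin cos 0 x x0 (fun y _ => is_derive_sin y).
  by apply: continuous_subspaceT; exact: continuous_sin.
by rewrite in_itv/= sin0 !subr0 => cx ->; exists c.
Qed.

Lemma sin_le x : 0 <= x -> sin x <= x.
Proof.
move=> x0; have [c _ ->] := sin_mvt x x0.
by rewrite ler_piMl// cos_le1.
Qed.

Lemma abs_sin_le x : `|sin x| <= `|x|.
Proof.
wlog x0 : x / 0 <= x => [h|].
  have [/h//|/ltW x0] := lerP 0 x.
  by rewrite -normrN -sinN -(normrN x); apply: h; rewrite oppr_ge0.
have [c _ ->] := sin_mvt x x0.
by rewrite normrM ler_piMl// cos_max.
Qed.

Lemma cos_ge x : 1 - x ^+ 2 / 2 <= cos x.
Proof.
have -> : cos x = 1 - 2 * sin (x / 2) ^+ 2.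
  rewrite sin2cos2 {1}(_ : x = (x / 2) *+ 2); last by rewrite mulr2n; field.
  by rewrite cos_mulr2n mulr2n; ring.
have : `|sin (x / 2)| ^+ 2 <= `|x / 2| ^+ 2.
  by rewrite lerXn2r ?nnegrE ?normr_ge0 ?abs_sin_le.
rewrite !real_normK ?num_real// => h.
have -> : x ^+ 2 / 2 = 2 * (x / 2) ^+ 2 by field.
lra.
Qed.

Lemma sin_ge_half x : 0 <= x <= 1 -> x / 2 <= sin x.
Proof.
move=> /andP[x0 x1]; have [c /andP[c0 cx] ->] := sin_mvt x x0.
have := cos_ge c; have : c ^+ 2 <= 1 by rewrite exprn_ile1//; lra.
by move=> c2 cc; rewrite mulrC ler_wpM2r//; lra.
Qed.

Lemma trig_mid a b : let m := (a + b) / 2 in let h := (a - b) / 2 in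
  sin a - sin b = 2 * cos m * sin h /\ cos a - cos b = - (2 * sin m * sin h).
Proof.
move=> m h.
have ea : a = m + h by rewrite /m /h; field.
have eb : b = m - h by rewrite /m /h; field.
by rewrite ea eb !(sinD, cosD, sinN, cosN); split; ring.
Qed.

Lemma sin_lip a b : `|sin a - sin b| <= `|a - b|.
Proof.
have [-> _] := trig_mid a b; rewrite !normrM.
have := abs_sin_le ((a - b) / 2); have := cos_max ((a + b) / 2).
rewrite (normrM (a - b)) normfV (ger0_norm (_ : 0 <= 2))// => c1 s1.
have := normr_ge0 (cos ((a + b) / 2)); have := normr_ge0 (sin ((a - b) / 2)).
nra.
Qed.

Lemma cos_lip a b : `|cos a - cos b| <= `|a - b|.
Proof.
have [_ ->] := trig_mid a b; rewrite normrN !normrM.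
have := abs_sin_le ((a - b) / 2); have := sin_max ((a + b) / 2).
rewrite (normrM (a - b)) normfV (ger0_norm (_ : 0 <= 2))// => c1 s1.
have := normr_ge0 (sin ((a + b) / 2)); have := normr_ge0 (sin ((a - b) / 2)).
nra.
Qed.

(* In the direction of slope 2 the projected corners of the squares are equally
   spaced: x + 2y = 3m / 4^n for the square of index m. *)
Definition theta0 : R := atan 2.
Definition c0 : R := cos theta0.

Lemma c0_gt0 : 0 < c0.
Proof. by apply: cos_gt0_pihalf; rewrite atan_gtNpi2 atan_ltpi2. Qed.

Lemma sin_theta0 : sin theta0 = 2 * c0.
Proof.
have := atanK (2 : R); rewrite /tan -/theta0 -/c0 => h.
by rewrite -[in RHS]h divfK// gt_eqF// c0_gt0.
Qed.

Lemma c0_sqr : 5 * c0 ^+ 2 = 1.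
Proof.
have := cos2Dsin2 theta0; rewrite sin_theta0 -/c0 => h.
by rewrite -[RHS]h; ring.
Qed.

Lemma c0_bounds : 44 / 100 <= c0 <= 1 / 2.
Proof. by have := c0_sqr; have := c0_gt0; rewrite expr2 => c c2; apply/andP; split; nra. Qed.

Lemma theta0_bounds : 0 <= theta0 <= pi / 2.
Proof.
rewrite /theta0 (ltW (atan_ltpi2 _)) andbT leNgt; apply/negP => t.
have : 0 < sin theta0 by rewrite sin_theta0; have := c0_gt0; lra.
rewrite -[theta0]opprK sinN oppr_gt0 => h.
have : 0 < sin (- theta0).
  apply: sin_gt0_pihalf; rewrite oppr_gt0 t/=.
  by have := atan_gtNpi2 (2 : R); rewrite -/theta0; lra.
by rewrite ltNge (ltW h).
Qed.

Lemma cos_shift s : cos (theta0 + s) = c0 * (cos s - 2 * sin s).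
Proof. by rewrite cosD sin_theta0 -/c0; ring. Qed.

Lemma sin_shift s : sin (theta0 + s) = c0 * (2 * cos s + sin s).
Proof. by rewrite sinD sin_theta0 -/c0; ring. Qed.

End Trig.

(** * The projection curved by circles of radius [r] *)

Section CurvedProjection.
Variable R : realType.
Implicit Types (r th x S p s : R) (z : R * R).

Definition perp th z : R := - z.1 * sin th + z.2 * cos th.

(* [centre r th z] locates the centre of the circle of radius [r] through [z]
   whose centre lies on the line of direction [th], to the far side of [z]. *)
Definition centre r th z : R :=
  proj th z + Num.sqrt (r ^+ 2 - perp th z ^+ 2).

Definition in_square z : Prop := 0 <= z.1 <= 1 /\ 0 <= z.2 <= 1.

(** Projecting after the last rotation reads off the abscissa in the rotated frame; the bound on
    [perp] selects the first branch of [f_r]. *)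
Lemma proj_sigma r th z : `|perp th z| <= 2 ->
  proj th (sigma r th z) = centre r th z - r.
Proof.
move=> h; rewrite /sigma /sigma0 /rotcw /proj /= -/(perp th z) /f_r h cosN sinN.
rewrite /centre /proj; set a := z.1 * cos th + z.2 * sin th.
set q := Num.sqrt _; set b := perp th z.
transitivity ((a - (r - q)) * (cos th ^+ 2 + sin th ^+ 2)); first by ring.
by rewrite cos2Dsin2; ring.
Qed.

Lemma abs_lin_trig (a b : R) th : 0 <= a <= 1 -> 0 <= b <= 1 ->
  `|a * cos th + b * sin th| <= 2 /\ `|- a * sin th + b * cos th| <= 2.
Proof.
move=> /andP[a0 a1] /andP[b0 b1].
have := cos_max th; have := sin_max th; rewrite !ler_norml.
move=> /andP[s1 s2] /andP[c1 c2]; split; apply/andP; split; nra.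
Qed.

Lemma proj_perp_sqr th z : proj th z ^+ 2 + perp th z ^+ 2 = z.1 ^+ 2 + z.2 ^+ 2.
Proof.
transitivity ((z.1 ^+ 2 + z.2 ^+ 2) * (cos th ^+ 2 + sin th ^+ 2)).
  by rewrite /proj /perp; ring.
by rewrite cos2Dsin2 mulr1.
Qed.

Lemma perp_le2 th z : in_square z -> `|perp th z| <= 2.
Proof. by case=> h1 h2; have [] := abs_lin_trig z.1 z.2 th h1 h2. Qed.

Lemma proj_le2 th z : in_square z -> `|proj th z| <= 2.
Proof. by case=> h1 h2; have [] := abs_lin_trig z.1 z.2 th h1 h2. Qed.

(** With [S] the squared norm, the equation is [(p - x)^2 + (S - x^2) = r^2], and the bounds on
    [p - x] select the larger root. No square root is left, and [S] does not depend on the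
    direction. *)
Definition on_circle r x S p : Prop :=
  [/\ p ^+ 2 - 2 * p * x + S = r ^+ 2, r - 2 <= p - x <= r & -2 <= x <= 2].

Lemma centreP r th z : 2 <= r -> in_square z ->
  on_circle r (proj th z) (z.1 ^+ 2 + z.2 ^+ 2) (centre r th z).
Proof.
move=> r2 zs; have y2 := perp_le2 th z zs; have x2 := proj_le2 th z zs.
have ysq : perp th z ^+ 2 <= 4.
  rewrite -real_normK ?num_real//.
  by have := normr_ge0 (perp th z); rewrite !expr2; nra.
have h0 : 0 <= r ^+ 2 - perp th z ^+ 2 by rewrite subr_ge0 (le_trans ysq)// expr2; nra.
have sq := sqr_sqrtr h0; have q0 := sqrtr_ge0 (r ^+ 2 - perp th z ^+ 2).
have pp := proj_perp_sqr th z; have y0 := sqr_ge0 (perp th z).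
rewrite /on_circle /centre -pp; move: sq q0; set q := Num.sqrt _ => sq q0.
split; [| |by rewrite -ler_norml].
- by transitivity (q ^+ 2 + perp th z ^+ 2); [ring|rewrite sq; ring].
- rewrite addrAC subrr add0r; apply/andP; split.
    by rewrite -(@ler_pXn2r _ 2)// ?nnegrE ?sq//; [rewrite !expr2 in ysq *; nra|lra].
  by rewrite -(@ler_pXn2r _ 2)// ?nnegrE ?sq//; lra.
Qed.

(** Subtracting the circle equations leaves [p - p'] times [(p + p' - 2 x) / (2 p')]; this quotient
    is at most 2, since [p] and [p'] are within 4 of [r]. *)
Lemma collision_proj r x S p x' S' p' d : 
  100 <= r ->
  on_circle r x S p -> on_circle r x' S' p' -> `|p - p'| <= d ->
  `|x - x' - (S - S') / (2 * p')| <= 2 * d.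
Proof.
move=> r100 [e /andP[q1 q2] /andP[x1 x2]] [e' /andP[q1' q2'] /andP[x1' x2']] pd.
have p'0 : 0 < p' by lra.
have -> : x - x' - (S - S') / (2 * p') = (p - p') * ((p + p' - 2 * x) / (2 * p')).
  have -> : S - S' = 2 * p' * (x - x') - (p - p') * (p + p' - 2 * x).
    have h0 : p ^+ 2 - 2 * p * x + S - (p' ^+ 2 - 2 * p' * x' + S') = 0 by rewrite e e' subrr.
    by rewrite -[LHS]subr0 -h0; ring.
  by field; rewrite gt_eqF.
rewrite normrM (ger0_norm (_ : 0 <= (p + p' - 2 * x) / (2 * p'))); last first.
  by apply: divr_ge0; lra.
rewrite mulrC ler_pM//; first by apply: divr_ge0; lra.
by rewrite ler_pdivrMr; lra.
Qed.

(** One point seen in two directions has one [S]; subtraction gives the ratio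
    [2 p2 / (p1 + p2 - 2 x1)], at most [(2 r + 4) / (2 r - 8)]. *)
Lemma centre_lip r x1 x2 S p1 p2 :
  100 <= r ->
  on_circle r x1 S p1 -> on_circle r x2 S p2 -> `|p1 - p2| <= 3 / 2 * `|x1 - x2|.
Proof.
move=> r100 [e /andP[q1 q2] /andP[a1 a2]] [e' /andP[q1' q2'] /andP[a1' a2']].
have h : (p1 - p2) * (p1 + p2 - 2 * x1) = 2 * p2 * (x1 - x2).
  have h0 : p1 ^+ 2 - 2 * p1 * x1 + S - (p2 ^+ 2 - 2 * p2 * x2 + S) = 0 by rewrite e e' subrr.
  by rewrite -[LHS]subr0 -h0; ring.
have : `|p1 - p2| * (p1 + p2 - 2 * x1) = 2 * p2 * `|x1 - x2|.
  have d0 : 0 <= p1 + p2 - 2 * x1 by lra.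
  have p0 : 0 <= 2 * p2 by lra.
  by rewrite -[X in _ * X](ger0_norm d0) -[X in X * `|x1 - x2|](ger0_norm p0) -!normrM h.
have := normr_ge0 (p1 - p2); have := normr_ge0 (x1 - x2).
move: `|p1 - p2| `|x1 - x2| => u v v0 u0 uv.
have h1 : u * (2 * r - 8) <= u * (p1 + p2 - 2 * x1) by rewrite ler_wpM2l//; lra.
have h2 : 2 * p2 * v <= (2 * r + 4) * v by rewrite ler_wpM2r//; lra.
have h3 : (2 * r + 4) * v <= 3 / 2 * v * (2 * r - 8).
  have r16 : 0 <= r - 16 by lra.
  by have := mulr_ge0 v0 r16; lra.
rewrite -(@ler_pM2r _ (2 * r - 8)); lra.
Qed.

(** Used along the vertical side of a square: the change of [S] costs a term of order [L / r], so at
    least half of the length survives. *)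
Lemma centre_rise r x0 S0 p0 x1 S1 p1 L sn :
  100 <= r ->
  on_circle r x0 S0 p0 -> on_circle r x1 S1 p1 ->
  0 <= L -> 8 / 10 <= sn -> x1 - x0 = L * sn -> S1 - S0 <= 3 * L ->
  p0 + L / 2 <= p1.
Proof.
move=> r100 [e /andP[q1 q2] /andP[a1 a2]] [e' /andP[q1' q2'] /andP[a1' a2']].
move=> L0 sn8 xL SL.
have h : (p1 - p0) * (p1 + p0 - 2 * x1) = 2 * p0 * (x1 - x0) - (S1 - S0).
  have h0 : p1 ^+ 2 - 2 * p1 * x1 + S1 - (p0 ^+ 2 - 2 * p0 * x0 + S0) = 0 by rewrite e e' subrr.
  by rewrite -[LHS]subr0 -h0; ring.
have d0 : 0 < p1 + p0 - 2 * x1 by lra.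
have x01 : 0 <= x1 - x0 by rewrite xL mulr_ge0//; lra.
have d1 : p1 + p0 - 2 * x1 <= 2 * r by lra.
have h1 : L * (8 / 10 * (2 * r - 8)) <= 2 * p0 * (x1 - x0).
  have a : 8 / 10 * (2 * r - 8) <= sn * (2 * p0) by apply: ler_pM; lra.
  by have := ler_wpM2l L0 a; rewrite xL; lra.
rewrite -lerBrDl -(ler_pM2r d0) h.
have h2 : L / 2 * (p1 + p0 - 2 * x1) <= L / 2 * (2 * r) by rewrite ler_wpM2l//; lra.
have h3 : L * r + 3 * L <= L * (8 / 10 * (2 * r - 8)).
  have b : 0 <= 6 / 10 * r - 94 / 10 by lra.
  by have := mulr_ge0 L0 b; lra.
lra.
Qed.

Lemma proj_lip z th th' : in_square z -> `|proj th z - proj th' z| <= 2 * `|th - th'|.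
Proof.
move=> [/andP[a0 a1] /andP[b0 b1]].
have -> : proj th z - proj th' z =
    z.1 * (cos th - cos th') + z.2 * (sin th - sin th') by rewrite /proj; ring.
rewrite (le_trans (ler_normD _ _))// !normrM (ger0_norm a0) (ger0_norm b0).
have := cos_lip _ th th'; have := sin_lip _ th th'.
have := normr_ge0 (cos th - cos th'); have := normr_ge0 (sin th - sin th').
move: `|_ - _| `|cos _ - _| `|th - _| => u v w; nra.
Qed.

Lemma centre_angle_lip r z th th' : 100 <= r -> in_square z ->
  `|centre r th z - centre r th' z| <= 3 * `|th - th'|.
Proof.
move=> r100 zs; have r2 : 2 <= r by lra.
have := centre_lip r _ _ _ _ _ r100 (centreP r th z r2 zs) (centreP r th' z r2 zs).
have := proj_lip z th th' zs; lra.
Qed.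

Lemma centre_continuous r th (z e : R * R) :
  continuous (fun t : R => centre r th (z.1 + t * e.1, z.2 + t * e.2)).
Proof.
move=> t; rewrite /centre /proj /perp/=.
have lin (a b : R) : (fun t : R => a + t * b) @ t --> a + t * b.
  by apply: cvgD; [exact: cvg_cst|apply: cvgMl; exact: cvg_id].
apply: cvgD.
  by apply: cvgD; (apply: cvgMl; exact: lin).
apply: continuous_cvg; first exact: sqrt_continuous.
apply: cvgB; first exact: cvg_cst.
rewrite expr2; under eq_fun do rewrite expr2.
have h : (fun t : R => - (z.1 + t * e.1) * sin th + (z.2 + t * e.2) * cos th) @ t
    --> - (z.1 + t * e.1) * sin th + (z.2 + t * e.2) * cos th.
  by apply: cvgD; apply: cvgMl; [apply: cvgN; exact: lin|exact: lin].
by apply: cvgM; exact: h.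
Qed.

Lemma image_segment r th (z e : R * R) (L y : R) (E : set (R * R)) : 0 <= L ->
  (forall t, 0 <= t <= L ->
     E (z.1 + t * e.1, z.2 + t * e.2) /\
     `|perp th (z.1 + t * e.1, z.2 + t * e.2)| <= 2) ->
  centre r th z <= y + r <= centre r th (z.1 + L * e.1, z.2 + L * e.2) ->
  (proj th @` (sigma r th @` E)) y.
Proof.
move=> L0 hE /andP[y1 y2].
have [||t] := @IVT R (fun t : R => centre r th (z.1 + t * e.1, z.2 + t * e.2))
   0 L (y + r) L0.
- by apply: continuous_subspaceT; exact: centre_continuous.
- by rewrite !mul0r !addr0 -surjective_pairing ge_min y1 le_max y2 orbT.
rewrite in_itv/= => /hE[Et yt] ct.
exists (sigma r th (z.1 + t * e.1, z.2 + t * e.2)).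
  by exists (z.1 + t * e.1, z.2 + t * e.2).
by rewrite proj_sigma// ct addrK.
Qed.

End CurvedProjection.

(** * Transversality in the presence of small curvature *)

Section Transversality.
Variable R : realType.
Implicit Types (U W Q p r tau s : R).

Lemma cos_small s : 0 <= s <= 1 / 64 -> 99 / 100 <= cos s.
Proof.
move=> /andP[s0 s1]; have := cos_ge _ s.
have : s ^+ 2 <= (1 / 64) ^+ 2 by rewrite lerXn2r// nnegrE; lra.
lra.
Qed.

Lemma collision_slope U W Q p r tau s :
  tau <= 1 / 64 -> 0 <= s <= tau -> 100 <= r * tau -> r / 2 <= p ->
  `|Q| <= 2 * (`|U| + `|W|) ->
  `|c0 R * (U * cos s + W * sin s) - Q / (2 * p)| <= 1 / 4 ->
  `|U| <= 2 + 2 * (tau * `|W|).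
Proof.
move=> tau64 /andP[s0 st] rt rp QA h.
have tau0 : 0 < tau by rewrite lt_neqAle (le_trans s0 st) andbT; apply/eqP => t0; move: rt; rewrite -t0 mulr0; lra.
have r0 : 0 < r by rewrite -(pmulr_lgt0 _ tau0) mulrC; lra.
have p0 : 0 < p by lra.
have c99 : 99 / 100 <= cos s by apply: cos_small; lra.
have sn0 : 0 <= sin s by have := sin_ge_half _ s; lra.
have snt : sin s <= tau by have := sin_le _ s s0; lra.
have /andP[c44 _] := c0_bounds R.
set G := U * cos s + W * sin s in h.
have QG : `|Q / (2 * p)| <= tau * (`|U| + `|W|) / 50.
  rewrite normrM normfV (gtr0_norm (_ : 0 < 2 * p)); last lra.
  rewrite ler_pdivrMr; last lra.
  apply: (le_trans QA).
  have A0 : 0 <= `|U| + `|W| by rewrite addr_ge0.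
  have tp : 100 <= 2 * p * tau by apply: (le_trans rt); rewrite ler_pM2r//; lra.
  have := ler_wpM2l A0 tp; lra.
have GG : c0 R * `|G| <= 1 / 4 + tau * (`|U| + `|W|) / 50.
  have -> : c0 R * `|G| = `|c0 R * G| by rewrite normrM gtr0_norm// c0_gt0.
  have := ler_normD (c0 R * G - Q / (2 * p)) (Q / (2 * p)); rewrite subrK; lra.
have G44 : 44 / 100 * `|G| <= c0 R * `|G| by rewrite ler_wpM2r.
have UG : `|U| * cos s <= `|G| + `|W| * sin s.
  have -> : `|U| * cos s = `|G - W * sin s|.
    by rewrite /G addrK normrM (ger0_norm (_ : 0 <= cos s))//; lra.
  by rewrite (le_trans (ler_normB _ _))// normrM (ger0_norm sn0).
have := ler_wpM2l (normr_ge0 U) c99; have := ler_wpM2l (normr_ge0 W) snt.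
have := ler_wpM2r (normr_ge0 U) tau64.
have := mulr_ge0 (ltW tau0) (normr_ge0 W).
have := mulr_ge0 (ltW tau0) (normr_ge0 U).
move: (normr_ge0 U); lra.
Qed.

(** Subtracting the two conditions leaves [2 sin h (W cos m - U sin m)], where the bracket is
    comparable to [W] because [m] is small and [|U| <= |W|]. The curvature terms change by a small
    multiple of [h |W|], so [h |W|] is bounded. *)
Lemma collision_angles U W Q p1 p2 r s1 s2 q :
  0 <= s2 <= s1 -> s1 <= 1 / 64 -> 100 <= r -> r / 2 <= p1 -> r / 2 <= p2 ->
  `|p1 - p2| <= 3 * (s1 - s2) -> `|Q| <= 2 * (`|U| + `|W|) ->
  `|c0 R * (U * cos s1 + W * sin s1) - Q / (2 * p1)| <= 1 / 4 ->
  `|c0 R * (U * cos s2 + W * sin s2) - Q / (2 * p2)| <= 1 / 4 ->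
  `|U| <= `|W| -> 3 * q <= `|W| -> (s1 - s2) * q <= 1.
Proof.
move=> /andP[s20 s21] s164 r100 rp1 rp2 p12 QA h1 h2 UW qW.
have [sE cE] := trig_mid _ s1 s2.
set m := (s1 + s2) / 2 in sE cE; set h := (s1 - s2) / 2 in sE cE.
set G1 := U * cos s1 + W * sin s1 in h1; set G2 := U * cos s2 + W * sin s2 in h2.
have GE : G1 - G2 = 2 * sin h * (W * cos m - U * sin m).
  transitivity (U * (cos s1 - cos s2) + W * (sin s1 - sin s2)); first by rewrite /G1 /G2; ring.
  by rewrite sE cE; ring.
have w0 := normr_ge0 W.
have m0 : 0 <= m <= 1 / 64 by rewrite /m; lra.
have cm : 99 / 100 <= cos m := cos_small m m0.
have sm : 0 <= sin m <= 1 / 64.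
  have := sin_ge_half _ m; have := sin_le _ m; lra.
have hh : h / 2 <= sin h by apply: sin_ge_half; rewrite /h; lra.
have h0 : 0 <= h by rewrite /h; lra.
have V97 : 97 / 100 * `|W| <= `|W * cos m - U * sin m|.
  have : `|W * cos m| <= `|W * cos m - U * sin m| + `|U * sin m|.
    by rewrite -{1}[W * cos m](subrK (U * sin m)) ler_normD.
  rewrite !normrM (ger0_norm (_ : 0 <= cos m)); last lra.
  case/andP: sm => sm0 sm1; rewrite (ger0_norm sm0).
  have := ler_wpM2l (normr_ge0 U) sm1; have := ler_wpM2l w0 cm; lra.
have G97 : 97 / 100 * (h * `|W|) <= `|G1 - G2|.
  rewrite GE normrM (ger0_norm (_ : 0 <= 2 * sin h)); last lra.
  have hs : h <= 2 * sin h by lra.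
  have V0 : 0 <= 97 / 100 * `|W| by lra.
  have := ler_pM h0 V0 hs V97; lra.
have PQ : `|Q / (2 * p1) - Q / (2 * p2)| <= 24 / 1000 * (h * `|W|).
  have p10 : 0 < p1 by lra.
  have p20 : 0 < p2 by lra.
  have -> : Q / (2 * p1) - Q / (2 * p2) = Q * (p2 - p1) / (2 * (p1 * p2)).
    by field; rewrite !gt_eqF.
  have pp : 2500 <= p1 * p2.
    rewrite (_ : 2500 = 50 * 50); last by lra.
    by apply: ler_pM; lra.
  rewrite normrM normfV (gtr0_norm (_ : 0 < 2 * (p1 * p2))); last lra.
  rewrite ler_pdivrMr; last lra.
  rewrite normrM distrC.
  have Q4 : `|Q| <= 4 * `|W| by lra.
  have p6 : `|p1 - p2| <= 6 * h by rewrite /h; lra.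
  have a := ler_pM (normr_ge0 Q) (normr_ge0 _) Q4 p6.
  have hw := mulr_ge0 h0 w0.
  have := ler_wpM2l hw pp; lra.
have GG : c0 R * `|G1 - G2| <= 1 / 2 + 24 / 1000 * (h * `|W|).
  have -> : c0 R * `|G1 - G2| = `|c0 R * G1 - c0 R * G2|.
    by rewrite -mulrBr normrM (gtr0_norm (c0_gt0 R)).
  rewrite (_ : c0 R * G1 - c0 R * G2 = (c0 R * G1 - Q / (2 * p1)) +
    ((Q / (2 * p1) - Q / (2 * p2)) - (c0 R * G2 - Q / (2 * p2)))); last by ring.
  apply: (le_trans (ler_normD _ _)).
  have := ler_normB (Q / (2 * p1) - Q / (2 * p2)) (c0 R * G2 - Q / (2 * p2)); lra.
have /andP[c44 _] := c0_bounds R.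
have G44 : 44 / 100 * `|G1 - G2| <= c0 R * `|G1 - G2| by rewrite ler_wpM2r.
have hq := ler_wpM2l h0 qW.
have -> : s1 - s2 = 2 * h by rewrite /h; field.
lra.
Qed.

End Transversality.

(** * Grid angles and the cells covered by a square *)

Section Collisions.
Variable R : realType.
Implicit Types (r : R) (n m i j l : nat).

Definition corner n m : R * R :=
  ((digx n m)%:R / 4 ^+ n, (digy n m)%:R / 4 ^+ n).

(** Indices below [4 ^ n] fill an interval of length 1/64 after [theta0]; for [100 <= r], one step
    moves a centre by at most 3/8 of a cell. *)
Definition angle n i : R := theta0 R + i%:R / (64 * 4 ^+ n).

(* The shift by 2 makes the cell lie inside the projection of the whole square,
   for every direction between [angle n i] and [angle n i.+1]. *)
Definition cell_index r n i m : int :=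
  Num.floor ((centre R r (angle n i) (corner n m) - r) * (8 * 4 ^+ n)) + 2.

Lemma exp4_gt0 n : 0 < 4 ^+ n :> R. Proof. by rewrite exprn_gt0. Qed.

Lemma digit_frac (d n : nat) (t : R) : (d < 4 ^ n)%N -> 0 <= t <= 4 ^- n ->
  0 <= d%:R / 4 ^+ n + t <= 1.
Proof.
move=> dn /andP[t0 t1]; have N0 := exp4_gt0 n.
have q0 : 0 <= d%:R / 4 ^+ n :> R by rewrite divr_ge0// ltW.
have : d%:R / 4 ^+ n + 4 ^- n <= 1 :> R.
  rewrite -[X in _ + X]mul1r -mulrDl ler_pdivrMr// mul1r natr1 -natrX.
  by rewrite ler_nat.
lra.
Qed.

Lemma corner_in_square n m : in_square R (corner n m).
Proof.
have N0 : 0 <= (0 : R) <= 4 ^- n by rewrite lexx invr_ge0 ltW// exp4_gt0.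
split; rewrite /= -[X in 0 <= X <= 1]addr0.
  exact: digit_frac (digx_lt _ _) N0.
exact: digit_frac (digy_lt _ _) N0.
Qed.

(** Along the left side of the square the centre rises by at least four cell widths. The chosen cell
    lies between one and three widths above the corner value at [angle n i], and passing to [th]
    costs at most one width. *)
Lemma cell_subset_image r n i m (th : R) : 100 <= r -> (i < 4 ^ n)%N ->
  angle n i <= th <= angle n i.+1 ->
  grid_cell R (8 * 4 ^+ n)^-1 (cell_index r n i m) `<=`
    proj th @` (sigma r th @` cantorK n).
Proof.
move=> r100 iN /andP[th1 th2] y; rewrite /grid_cell/= in_itv/= /cell_index.
set N : R := 4 ^+ n; have N0 : 0 < N := exp4_gt0 n.
set ci := centre R r (angle n i) (corner n m).
have /andP[f1 f2] := floor_itv ((ci - r) * (8 * N)).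
move: f1 f2; set f := Num.floor _ => f1 f2.
rewrite !intrD in f2 *; move: f1 f2; set g : R := f%:~R => f1 f2.
have E : 0 < 8 * N by lra.
rewrite -[X in X <= y](mulrC (8 * N)^-1) ler_pdivrMl// ltr_pdivlMr//.
move=> /andP[y1 y2].
have z1 := corner_in_square n m.
have L0 : 0 <= N^-1 by rewrite invr_ge0 ltW.
have z2 : in_square R ((corner n m).1 + N^-1 * 0, (corner n m).2 + N^-1 * 1).
  split; first by rewrite /= mulr0 addr0; case: z1.
  by rewrite /= mulr1; apply: digit_frac; rewrite ?digy_lt// L0 lexx.
have NV : N * N^-1 = 1 by rewrite mulfV// gt_eqF.
have dth : 3 * `|th - angle n i| <= N^-1 / 8.
  have : angle n i.+1 - angle n i = N^-1 / 64.
    by rewrite /angle -natr1 /N; field; rewrite gt_eqF// exp4_gt0.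
  by rewrite ger0_norm; lra.
have cth := centre_angle_lip _ r (corner n m) th (angle n i) r100 z1.
have r2 : 2 <= r by lra.
have sth : 8 / 10 <= sin th.
  pose s := th - theta0 R.
  have sE : 0 <= s <= 1 / 64.
    rewrite /s; move: th1 th2; rewrite /angle => th1 th2.
    have a0 : 0 <= i%:R / (64 * 4 ^+ n) :> R by rewrite divr_ge0// mulr_ge0// ltW.
    have a1 : i.+1%:R / (64 * 4 ^+ n) <= 1 / 64 :> R.
      rewrite ler_pdivrMr -/N; last lra.
      by rewrite mulrA mul1r mulVf// mul1r /N -natrX ler_nat.
    lra.
  have := cos_small _ s sE; have := sin_ge_half _ s; have := c0_bounds R.
  have -> : th = theta0 R + s by rewrite /s; ring.
  rewrite sin_shift => /andP[c44 _] hs hc.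
  have hh : 198 / 100 <= 2 * cos s + sin s by lra.
  have := @ler_pM R (44 / 100) (c0 R) (198 / 100) (2 * cos s + sin s); lra.
have rise := centre_rise _ r _ _ _ _ _ _ (N^-1) (sin th) r100
  (centreP _ r th _ r2 z1) (centreP _ r th _ r2 z2) L0 sth.
apply: (image_segment _ r th (corner n m) (0, 1) (N^-1)) => //=.
  move=> t tL; rewrite mulr0 addr0 mulr1; split.
    rewrite -[X in (X, _)]addr0; apply: cantorK_corner => //.
    by rewrite lexx L0.
  apply: perp_le2; split; first by case: z1.
  by apply: digit_frac => //; exact: digy_lt.
have /= {}rise := rise _ _.
move: cth; rewrite -/ci ler_norml => /andP[ct1 ct2].
have y1' : ci - r + N^-1 / 8 <= y.
  rewrite -(ler_pM2r E) mulrDl.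
  have -> : N^-1 / 8 * (8 * N) = 1 by field; rewrite gt_eqF.
  lra.
have y2' : y <= ci - r + N^-1 / 8 * 3.
  rewrite -(ler_pM2r E) [leRHS]mulrDl.
  have -> : N^-1 / 8 * 3 * (8 * N) = 3 by field; rewrite gt_eqF.
  lra.
apply/andP; split; first by lra.
apply: (@le_trans _ _ (centre R r th (corner n m) + N^-1 / 2)); first by lra.
apply: rise.
  by rewrite /proj/=; ring.
case: z2 => _ /=; case: z1 => _ /= /andP[b0 b1] /andP[b0' b1'].
rewrite !(mulr1, mulr0, addr0) in b0' b1' *.
set b := _ / _ in b0 b1 b0' b1' *.
have : N^-1 <= 1 by lra.
rewrite -subr_ge0 => l1; have := mulr_ge0 L0 l1.
have bb : 0 <= 1 - b by lra.
have := mulr_ge0 L0 bb; rewrite !expr2; lra.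
Qed.

End Collisions.

(** * Corner differences in units of [4 ^- n] *)

Section CollisionCount.
Variable R : realType.
Implicit Types (r : R) (n m i j l : nat).

Definition dX n m m' : R := (digx n m)%:R - (digx n m')%:R.
Definition dY n m m' : R := (digy n m)%:R - (digy n m')%:R.
(** [along] and [across] are inner products with [(1, 2)] and [(-2, 1)], parallel and orthogonal to
    slope 2. *)
Definition along n m m' : R := dX n m m' + 2 * dY n m m'.
Definition across n m m' : R := dY n m m' - 2 * dX n m m'.

Definition sqdiff n m m' : R := 4 ^+ n *
  (((corner R n m).1 ^+ 2 + (corner R n m).2 ^+ 2) -
   ((corner R n m').1 ^+ 2 + (corner R n m').2 ^+ 2)).

Lemma abs_sqdiff n m m' :
  `|sqdiff n m m'| <= 2 * (`|along n m m'| + `|across n m m'|).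
Proof.
have [/andP[a0 a1] /andP[b0 b1]] := corner_in_square R n m.
have [/andP[a0' a1'] /andP[b0' b1']] := corner_in_square R n m'.
have -> : sqdiff n m m' =
    dX n m m' * ((corner R n m).1 + (corner R n m').1) +
    dY n m m' * ((corner R n m).2 + (corner R n m').2).
  by rewrite /sqdiff /corner /dX /dY/=; field; rewrite gt_eqF// exp4_gt0.
have X5 : dX n m m' = (along n m m' - 2 * across n m m') / 5.
  by rewrite /along /across; field.
have Y5 : dY n m m' = (2 * along n m m' + across n m m') / 5.
  by rewrite /along /across; field.
have hX : `|dX n m m'| <= (`|along n m m'| + 2 * `|across n m m'|) / 5.
  rewrite X5 normrM (ger0_norm (_ : 0 <= 5^-1))// ler_pM2r//.
  by rewrite (le_trans (ler_normB _ _))// normrM (ger0_norm (_ : 0 <= 2)).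
have hY : `|dY n m m'| <= (2 * `|along n m m'| + `|across n m m'|) / 5.
  rewrite Y5 normrM (ger0_norm (_ : 0 <= 5^-1))// ler_pM2r//.
  by rewrite (le_trans (ler_normD _ _))// normrM (ger0_norm (_ : 0 <= 2)).
apply: (le_trans (ler_normD _ _)); rewrite !normrM.
set u := (corner R n m).1 + _; set v := (corner R n m).2 + _.
have u2 : `|u| <= 2 by rewrite /u ger0_norm; lra.
have v2 : `|v| <= 2 by rewrite /v ger0_norm; lra.
have := ler_wpM2l (normr_ge0 (dX n m m')) u2.
have := ler_wpM2l (normr_ge0 (dY n m m')) v2.
have := normr_ge0 (along n m m'); have := normr_ge0 (across n m m').
lra.
Qed.

(** This is [collision_proj] scaled by [4 ^ n]: equal cells put the centres within
    [1 / (8 * 4 ^ n)], and doubling gives 1/4. *)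
Lemma collision_eq r n i m m' : 100 <= r ->
  cell_index R r n i m = cell_index R r n i m' ->
  `|c0 R * (along n m m' * cos (i%:R / (64 * 4 ^+ n)) +
            across n m m' * sin (i%:R / (64 * 4 ^+ n))) -
    sqdiff n m m' / (2 * centre R r (angle R n i) (corner R n m'))| <= 1 / 4.
Proof.
move=> r100 /addIr vE.
have N0 : 0 < 4 ^+ n :> R := exp4_gt0 R n.
have r2 : 2 <= r by lra.
have pd : `|centre R r (angle R n i) (corner R n m) -
            centre R r (angle R n i) (corner R n m')| <= (8 * 4 ^+ n)^-1.
  have E : 0 < 8 * 4 ^+ n :> R by lra.
  rewrite -[leRHS]mul1r ler_pdivlMr// -[X in _ * X](gtr0_norm E) -normrM.
  have := floor_itv ((centre R r (angle R n i) (corner R n m) - r) * (8 * 4 ^+ n)).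
  have := floor_itv ((centre R r (angle R n i) (corner R n m') - r) * (8 * 4 ^+ n)).
  rewrite -vE intrD => /andP[f1 f2] /andP[g1 g2].
  rewrite ler_norml; lra.
have := collision_proj _ r _ _ _ _ _ _ _ r100
  (centreP _ r (angle R n i) _ r2 (corner_in_square R n m))
  (centreP _ r (angle R n i) _ r2 (corner_in_square R n m')) pd.
have p0 : 0 < centre R r (angle R n i) (corner R n m').
  by have [_ /andP[+ _] /andP[+ _]] := centreP _ r (angle R n i) _ r2 (corner_in_square R n m'); lra.
rewrite -(ler_pM2l N0) => h; apply: (le_trans _ (le_trans h _)); last first.
  by rewrite le_eqVlt; apply/orP; left; apply/eqP; field; rewrite gt_eqF.
rewrite -[X in X * `|_|](gtr0_norm N0) -normrM le_eqVlt; apply/orP; left; apply/eqP.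
congr (`|_|); rewrite /proj {2 3 5 6}/angle !cos_shift !sin_shift.
rewrite /sqdiff /along /across /dX /dY /corner/=.
rewrite /corner/= in p0.
by field; rewrite gt_eqF//= gt_eqF.
Qed.

Lemma across_le n l m m' : (m %/ 4 ^ l = m' %/ 4 ^ l)%N ->
  `|across n m m'| <= 3 * 4 ^+ l.
Proof.
move=> e; have [x1 y1] := dig_block n l m m' e.
have [x2 y2] := dig_block n l m' m (esym e).
move: x1 y1 x2 y2; rewrite /across /dX /dY -!(ltr_nat R) !natrD !natrX.
by rewrite ler_norml; lra.
Qed.

Lemma along_index n m m' : (m < 4 ^ n)%N -> (m' < 4 ^ n)%N ->
  along n m m' = 3 * (m%:R - m'%:R).
Proof.
move=> mn m'n; have := digx_digy n m mn; have := digx_digy n m' m'n.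
move=> /(congr1 (fun k => k%:R : R)); rewrite natrD !natrM => e'.
move=> /(congr1 (fun k => k%:R : R)); rewrite natrD !natrM => e.
by rewrite /along /dX /dY; lra.
Qed.

(** By [dig_sep] one coordinate difference exceeds [2 * 4 ^ l], while [5 dX = along - 2 across] and
    [5 dY = 2 along + across]. *)
Lemma along_across_ge n l m m' : (l < n)%N ->
  (m %/ 4 ^ l.+1 = m' %/ 4 ^ l.+1)%N -> (m %/ 4 ^ l <> m' %/ 4 ^ l)%N ->
  10 * 4 ^+ l <= `|along n m m'| + 2 * `|across n m m'| \/
  10 * 4 ^+ l <= 2 * `|along n m m'| + `|across n m m'|.
Proof.
move=> ln e ne.
have hX : 5 * `|dX n m m'| <= `|along n m m'| + 2 * `|across n m m'|.
  rewrite -[5](ger0_norm (_ : 0 <= (5 : R)))// -normrM.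
  have -> : 5 * dX n m m' = along n m m' - 2 * across n m m'.
    by rewrite /along /across; ring.
  by rewrite (le_trans (ler_normB _ _))// normrM (ger0_norm (_ : 0 <= 2)).
have hY : 5 * `|dY n m m'| <= 2 * `|along n m m'| + `|across n m m'|.
  rewrite -[5](ger0_norm (_ : 0 <= (5 : R)))// -normrM.
  have -> : 5 * dY n m m' = 2 * along n m m' + across n m m'.
    by rewrite /along /across; ring.
  by rewrite (le_trans (ler_normD _ _))// normrM (ger0_norm (_ : 0 <= 2)).
have := ler_norm (dX n m m'); have := ler_norm (dY n m m').
have := ler_norm (- dX n m m'); have := ler_norm (- dY n m m').
rewrite !normrN; move: hX hY; set A := `|dX _ _ _|; set B := `|dY _ _ _|.
rewrite /dX /dY => hX hY a1 a2 a3 a4.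
by have [] := dig_sep n l m m' ln e ne; rewrite -(ltr_nat R) natrD natrM natrX => h;
  [left|left|right|right]; lra.
Qed.

End CollisionCount.

(** * The second moment bound on one ring of angles *)

Section SecondMoment.
Variable R : realType.
Implicit Types (r : R) (n m i j l : nat).

(* The ring of index [j] consists of the angles [theta0 + s] with
   4^-j / 4 <= s < 4^-j. *)
Definition ring_collision r n j i m m' : bool :=
  cell_index R r n (16 * 4 ^ (n - j) + i) m == cell_index R r n (16 * 4 ^ (n - j) + i) m'.

Lemma ring_angle n j i : (j <= n)%N -> (i < 48 * 4 ^ (n - j))%N ->
  0 <= ((16 * 4 ^ (n - j) + i)%:R / (64 * 4 ^+ n) : R) <= 4 ^- j.
Proof.
move=> jn iK; have N0 := exp4_gt0 R n; have j0 := exp4_gt0 R j.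
apply/andP; split; first by apply: divr_ge0 => //; lra.
rewrite ler_pdivrMr; last lra.
rewrite -[in leRHS](subnK jn) exprD [leRHS](_ : _ = 64 * 4 ^+ (n - j)); last first.
  by field; rewrite gt_eqF.
by rewrite -natrX -natrM ler_nat; lia.
Qed.

Lemma exp4_small j : (3 <= j)%N -> 4 ^- j <= 1 / 64 :> R.
Proof.
move=> j3; have j0 := exp4_gt0 R j.
rewrite -[leLHS]mul1r ler_pdivrMr// mulrAC ler_pdivlMr// !mul1r.
by rewrite (_ : 64 = 4 ^+ 3); [rewrite ler_eXn2l// ltr1n|ring].
Qed.

Lemma centre_ge r (th : R) n m : 100 <= r -> r / 2 <= centre R r th (corner R n m).
Proof.
move=> r100; have r2 : 2 <= r by lra.
have [_ /andP[+ _] /andP[+ _]] := centreP _ r th _ r2 (corner_in_square R n m).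
lra.
Qed.

Lemma ring_collision_slope r n j i m m' : (3 <= j <= n)%N -> 100 * 4 ^+ j <= r ->
  (i < 48 * 4 ^ (n - j))%N -> ring_collision r n j i m m' ->
  `|along R n m m'| <= 2 + 2 * (4 ^- j * `|across R n m m'|).
Proof.
move=> /andP[j3 jn] rj iK /eqP cE; have j0 := exp4_gt0 R j.
have j1 : 1 <= 4 ^+ j :> R by rewrite exprn_ege1// ler1n.
have r100 : 100 <= r by lra.
apply: (collision_slope _ _ _ _ _ r _ _ _ (ring_angle n j i jn iK)).
- exact: exp4_small.
- by rewrite ler_pdivlMr.
- exact: (centre_ge r (angle R n (16 * 4 ^ (n - j) + i)) n m').
- exact: abs_sqdiff.
- exact: collision_eq.
Qed.

(** Since [along = 3 (m - m')] and [|across| <= 3 * 4 ^ l.+1], the slope bound gives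
    [|m - m'| <= 2/3 + 2 * 4 ^ (l + 1 - j)], with a possibly negative exponent. *)
Lemma ring_collision_nearby r n j l m m' i : (3 <= j <= n)%N -> 100 * 4 ^+ j <= r ->
  (m < 4 ^ n)%N -> (m' < 4 ^ n)%N ->
  (m %/ 4 ^ l.+1 = m' %/ 4 ^ l.+1)%N ->
  (i < 48 * 4 ^ (n - j))%N -> ring_collision r n j i m m' ->
  nearby (if (j <= l.+1)%N then 3 * 4 ^ (l.+1 - j) + 1 else 4)%N m m'.
Proof.
move=> j3n rj mn m'n e iK coll.
have := ring_collision_slope r n j i m m' j3n rj iK coll.
have := across_le R n l.+1 m m' e; rewrite along_index//.
have j0 := exp4_gt0 R j; have ji0 : 0 <= 4 ^- j :> R by rewrite invr_ge0 ltW.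
move=> /(ler_wpM2l ji0) hw; rewrite ler_norml => /andP[h1 h2].
set t : R := 4 ^- j * _ in hw h1 h2.
have bound : m%:R <= m'%:R + 2 / 3 + 2 * (4 ^- j * 4 ^+ l.+1) :> R /\
             m'%:R <= m%:R + 2 / 3 + 2 * (4 ^- j * 4 ^+ l.+1) :> R by split; lra.
case: bound; set T : R := 4 ^- j * _; case: ifPn => jl b1 b2.
  have TE : T = 4 ^+ (l.+1 - j) by rewrite /T -{1}(subnK jl) exprD mulrC mulfK// gt_eqF.
  have T1 : 1 <= T by rewrite TE exprn_ege1// ler1n.
  by rewrite /nearby -!(ler_nat R) !natrD !natrX -TE; apply/andP; split; lra.
have T1 : T <= 1.
  rewrite /T mulrC ler_pdivrMr// mul1r ler_eXn2l ?ltr1n//.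
  by rewrite ltnW// ltnNge.
by rewrite /nearby -!(ler_nat R) !natrD; apply/andP; split; lra.
Qed.

(** The slope bound gives [|along| <= 2 + |across| / 32], so separation forces
    [|across| >= 3 * 4 ^ l]. Transversality with [q = 4 ^ l] bounds the angle difference by
    [4 ^- l], that is [64 * 4 ^ (n - l)] grid steps. *)
Lemma ring_collision_angles r n j l m m' i i' : (3 <= j <= n)%N ->
  100 * 4 ^+ j <= r -> (l < n)%N ->
  (m %/ 4 ^ l.+1 = m' %/ 4 ^ l.+1)%N -> (m %/ 4 ^ l <> m' %/ 4 ^ l)%N ->
  (i < 48 * 4 ^ (n - j))%N -> (i' < 48 * 4 ^ (n - j))%N ->
  ring_collision r n j i m m' -> ring_collision r n j i' m m' ->
  (i <= i' + 64 * 4 ^ (n - l))%N.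
Proof.
move=> j3n rj ln e ne iK i'K coll coll'.
have [ii'|i'i] := leqP i i'; first by rewrite (leq_trans ii')// leq_addr.
have /andP[j3 jn] := j3n; have j0 := exp4_gt0 R j.
have j1 : 1 <= 4 ^+ j :> R by rewrite exprn_ege1// ler1n.
have r100 : 100 <= r by lra.
have l1 : 1 <= 4 ^+ l :> R by rewrite exprn_ege1// ler1n.
have tau := exp4_small j j3; have N0 := exp4_gt0 R n.
have UW := ring_collision_slope r n j i m m' j3n rj iK coll.
have w0 := normr_ge0 (across R n m m').
have tw := ler_wpM2r w0 tau.
have W3 : 3 * 4 ^+ l <= `|across R n m m'|.
  by have [] := along_across_ge R n l m m' ln e ne; lra.
move/eqP: coll => coll; move/eqP: coll' => coll'.
have /andP[s1 s1'] := ring_angle n j i jn iK.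
have /andP[s2 _] := ring_angle n j i' jn i'K.
set I := (16 * 4 ^ (n - j) + i)%N in coll s1 s1'.
set I' := (16 * 4 ^ (n - j) + i')%N in coll' s2.
have II' : I'%:R / (64 * 4 ^+ n) <= I%:R / (64 * 4 ^+ n) :> R.
  by rewrite ler_pM2r ?invr_gt0; [rewrite ler_nat leq_add2l ltnW|lra].
have D : I%:R / (64 * 4 ^+ n) - I'%:R / (64 * 4 ^+ n) = (i%:R - i'%:R) / (64 * 4 ^+ n) :> R.
  by rewrite /I /I' !natrD; ring.
have := collision_angles R _ _ _ _ _ r _ _ (4 ^+ l) _ _ r100
  (centre_ge r (angle R n I) n m' r100) (centre_ge r (angle R n I') n m' r100)
  _ (abs_sqdiff R n m m') (collision_eq R r n I m m' r100 coll)
  (collision_eq R r n I' m m' r100 coll').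
rewrite s2 II' => /(_ isT) h.
have {}h : (i%:R - i'%:R) / (64 * 4 ^+ n) * 4 ^+ l <= 1 :> R.
  rewrite -D; apply: h => //; [by lra| |by lra].
  have := centre_angle_lip R r (corner R n m') (angle R n I) (angle R n I') r100
    (corner_in_square R n m').
  have -> : angle R n I - angle R n I' = I%:R / (64 * 4 ^+ n) - I'%:R / (64 * 4 ^+ n).
    by rewrite /angle; ring.
  by rewrite [X in _ <= 3 * X -> _]ger0_norm// subr_ge0.
rewrite -(ler_nat R) natrD natrM natrX -lerBlDl.
have l0 := exp4_gt0 R l.
rewrite -(ler_pM2r l0) -mulrA -exprD subnK; last exact: ltnW.
by move: h; rewrite mulrAC ler_pdivrMr ?mul1r//; lra.
Qed.

Lemma ring_collision_sum r n j : (3 <= j <= n)%N -> (4 ^ j <= n)%N ->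
  100 * 4 ^+ j <= r ->
  (\sum_(i < 48 * 4 ^ (n - j)) \sum_(m < 4 ^ n) \sum_(m' < 4 ^ n)
     ring_collision r n j i m m' <=
   (432 + 1152 * (2 * 64 + 1)) * (n * 4 ^ (2 * (n - j))))%N.
Proof.
move=> j3n j4 rj; have /andP[j3 jn] := j3n.
apply: (leq_trans (sum_collisions n j 64 _ (ring_collision r n j) jn _ _)).
- move=> l m m' i ln mn m'n e ne iK coll.
  exact: (ring_collision_nearby r n j l m m' i).
- move=> l m m' i i' ln mn m'n e ne iK i'K coll coll'.
  exact: (ring_collision_angles r n j l m m' i i').
rewrite mulnDl leq_add//; last first.
  by rewrite -(mulnA n) mulnCA (mulnC n) !mulnA.
(* Pairs charged for every angle are absorbed using [4 ^ j <= n]. *)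
have -> : (9 * 4 ^ n * (48 * 4 ^ (n - j)) = 432 * (4 ^ j * 4 ^ (2 * (n - j))))%N.
  rewrite mulnACA -!expnD; congr (_ * 4 ^ _)%N; lia.
by rewrite leq_mul2l leq_mul2r j4 !orbT.
Qed.

Definition cells r n i : nat :=
  size (undup [seq cell_index R r n i m | m <- iota 0 (4 ^ n)]).

Definition Ccoll : R := (432 + 1152 * (2 * 64 + 1))%:R.

Lemma Ccoll_gt0 : 0 < Ccoll. Proof. by rewrite ltr0n. Qed.

Lemma ring_cells_ge r n j : (3 <= j <= n)%N -> (4 ^ j <= n)%N ->
  100 * 4 ^+ j <= r ->
  48 ^+ 2 * (4 ^+ n) ^+ 2 / (Ccoll * n%:R) <=
  \sum_(i < 48 * 4 ^ (n - j)) (cells r n (16 * 4 ^ (n - j) + i))%:R.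
Proof.
move=> j3n j4 rj; have /andP[j3 jn] := j3n.
have n0 : 0 < n%:R :> R by rewrite ltr0n (leq_trans _ jn)// (leq_trans _ j3).
have N0 := exp4_gt0 R n; have nj0 := exp4_gt0 R (n - j); have C0 := Ccoll_gt0.
pose T := (\sum_(i < 48 * 4 ^ (n - j)) \sum_(m < 4 ^ n) \sum_(m' < 4 ^ n)
     ring_collision r n j i m m')%N.
have hT : T%:R <= Ccoll * (n%:R * (4 ^+ (n - j)) ^+ 2).
  have := ring_collision_sum r n j j3n j4 rj; rewrite -/T -(ler_nat R).
  by rewrite natrM (natrM _ n) natrX [(2 * (n - j))%N]mulnC exprM.
set B := Ccoll * _ in hT.
have B0 : 0 < B by rewrite /B !mulr_gt0.
(* [M] counts pairs of an angle and a square; [M / B] maximises [2 lam M - lam^2 B]. In the value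
   [M^2 / B] the dependence on [j] cancels, so all rings contribute equally. *)
pose M : R := 48 * 4 ^+ (n - j) * 4 ^+ n; pose lam := M / B.
apply: (@le_trans _ _ (2 * lam * M - lam ^+ 2 * T%:R)).
  apply: (@le_trans _ _ (2 * lam * M - lam ^+ 2 * B)).
    rewrite le_eqVlt; apply/orP; left; apply/eqP.
    by rewrite /lam /M /B; field; rewrite !gt_eqF.
  by rewrite lerD2l lerN2 ler_wpM2l// sqr_ge0.
have per i : 2 * lam * (4 ^ n)%:R - lam ^+ 2 *
    (\sum_(m < 4 ^ n) \sum_(m' < 4 ^ n) ring_collision r n j i m m')%:R <=
    (cells r n (16 * 4 ^ (n - j) + i))%:R.
  have := size_undup_map_ge R _ _ (iota 0 (4 ^ n))
    (cell_index R r n (16 * 4 ^ (n - j) + i)) lam.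
  rewrite size_iota; congr (_ - _ * _%:R <= _).
  have -> : iota 0 (4 ^ n) = index_iota 0 (4 ^ n) by rewrite /index_iota subn0.
  by rewrite big_mkord; apply: eq_bigr => m _; rewrite big_mkord.
apply: (le_trans _ (ler_sum _ (fun (i : 'I_(48 * 4 ^ (n - j))) _ => per i))).
rewrite sumrB sumr_const card_ord -big_distrr/= -natr_sum -/T lerD2r.
rewrite -[leRHS]mulr_natr natrM !natrX.
by rewrite le_eqVlt; apply/orP; left; apply/eqP; rewrite /M; ring.
Qed.

End SecondMoment.

(** * From cell counts to the Favard length *)

Section Assembly.
Variable R : realType.
Implicit Types (r : R) (n m i j : nat).



Lemma Fav_ge (T : R -> R * R -> R * R) E (K : nat) (c : nat -> R) (a d : R) :
  0 < d -> 0 <= a -> a + K%:R * d <= 2 * pi -> (forall i, 0 <= c i) ->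
  (forall i (th : R), (i < K)%N -> a + i%:R * d <= th <= a + i.+1%:R * d ->
     ((c i)%:E <= lebesgue_measure (proj th @` (T th @` E)))%E) ->
  (((2 * pi)^-1 * (d * \sum_(i < K) c i))%:E <= Fav T E)%E.
Proof.
move=> d0 a0 aK c0 cT; rewrite /Fav EFinM.
have pi0 : 0 < 2 * pi :> R by have := pi_ge2 R; lra.
apply: lee_wpmul2l; first by rewrite lee_fin invr_ge0 ltW.
pose F i : set R := `[a + i%:R * d, a + i.+1%:R * d[%classic.
have Fi i x : F i x -> a + i%:R * d <= x < a + i.+1%:R * d by rewrite /F/= in_itv.
have := @integral_ge_step R _ _ (@lebesgue_measure R) `[0%R, (2 * pi)%R]%classic
   (fun th => lebesgue_measure (proj th @` (T th @` E))) K c F.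
have -> : (\sum_(i < K) (c i)%:E * lebesgue_measure (F i) =
    (d * \sum_(i < K) c i)%:E)%E.
  rewrite big_distrr/= -sumEFin; apply: eq_bigr => i _.
  rewrite /F lebesgue_measure_itv/= lte_fin ltrD2l ltr_pM2r// ltr_nat ltnSn.
  rewrite -EFinD -EFinM; congr (_%:E); rewrite -natr1; ring.
apply => //.
- by move=> i; exact: measurable_itv.
- move=> i iK x /Fi /andP[x1 x2]; rewrite /= in_itv/=.
  have : i.+1%:R * d <= K%:R * d by rewrite ler_pM2r// ler_nat.
  have : 0 <= i%:R * d by rewrite mulr_ge0// ltW.
  by move=> h1 h2; apply/andP; split; lra.
- move=> i j x /Fi /andP[x1 x2] /Fi /andP[y1 y2].
  have : a + i%:R * d < a + j.+1%:R * d by exact: le_lt_trans y2.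
  have : a + j%:R * d < a + i.+1%:R * d by exact: le_lt_trans x2.
  by rewrite !ltrD2l !ltr_pM2r// !ltr_nat; lia.
- move=> i x iK /Fi /andP[x1 x2]; apply: cT => //.
  by rewrite x1 ltW.
Qed.

(** A crude bound for small [n]: at angles in [[0, 1/4]] the image of the bottom side of the square
    at the origin contains an interval of length [4 ^- n / 2]. *)
Lemma Fav_square_ge r n : 1 <= r ->
  (((2 * pi)^-1 * (1 / 4 * (4 ^- n / 2)))%:E <= Fav (sigma r) (cantorK n))%E.
Proof.
move=> r1; have N0 := exp4_gt0 R n; have L0 : 0 < 4 ^- n :> R by rewrite invr_gt0.
have -> : 4 ^- n / 2 = \sum_(i < 1) (4 ^- n / 2) :> R by rewrite big_ord1.
apply: (Fav_ge _ _ 1 (fun=> 4 ^- n / 2) 0 (1 / 4)) => //.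
- by have := pi_ge2 R; lra.

move=> i th; rewrite ltnS leqn0 => /eqP ->; rewrite mul0r mul1r add0r add0r => /andP[t0 t4].
set A := _ @` _; set L : R := 4 ^- n.
apply: (@le_trans _ _ (lebesgue_measure `[0, L / 2]%classic)).
  rewrite lebesgue_measure_itv/= lte_fin divr_gt0//.
  by rewrite -EFinD subr0.
apply: le_lebesgue_measure => y; rewrite /= in_itv/= => /andP[y0 yL].
apply: (image_segment R r th (0, 0) (1, 0) L y); first exact: ltW.
  move=> t tL /=; rewrite !(mulr1, mulr0, addr0, add0r).
  have tsq : in_square R (t, 0).
    by have := digit_frac R 0 n t; rewrite mul0r add0r => h; split; [apply: h; rewrite ?expn_gt0|rewrite /= lexx ler01].
  split; last exact: perp_le2.
  have h0 : 0 <= (0 : R) <= 4 ^- n by rewrite lexx ltW.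
  have dx0 k : digx k 0 = 0%N by elim: k => //= k ->.
  have dy0 k : digy k 0 = 0%N by elim: k => //= k ->.
  have := cantorK_corner R n 0 t 0; rewrite dx0 dy0 mul0r !add0r; exact.
have sn0 : 0 <= sin th by have := sin_ge_half _ th; lra.
have snt : sin th <= 1 / 4 by have := sin_le _ th t0; lra.
have cs : 1 - 1 / 32 <= cos th.
  have := cos_ge _ th; have : th ^+ 2 <= (1 / 4) ^+ 2 by rewrite lerXn2r// nnegrE; lra.
  lra.
rewrite /centre /proj /perp/= !(mulr1, mulr0, mul0r, addr0, add0r, oppr0).
rewrite expr0n/= subr0 sqrtr_sqr ger0_norm; last lra.
have LE : L <= 1.
  by rewrite /L -[leLHS]mul1r ler_pdivrMr// mul1r exprn_ege1// ler1n.
have q : r - L * sin th <= Num.sqrt (r ^+ 2 - (- L * sin th) ^+ 2).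
  have Ls : 0 <= L * sin th by rewrite mulr_ge0// ltW.
  have Ls1 : L * sin th <= 1 by have := ler_pM (ltW L0) sn0 LE snt; rewrite -/L; lra.
  apply: le_trans (ler_norm _) _; rewrite -sqrtr_sqr ler_wsqrtr//.
  rewrite mulNr sqrrN; set u := L * _ in Ls Ls1 *.
  have : 0 <= u * (r - u) by apply: mulr_ge0; lra.
  by rewrite !expr2; lra.
have := ler_wpM2l (ltW L0) cs; have := ler_wpM2l (ltW L0) snt; rewrite -/L.
by move=> h1 h2; apply/andP; split; lra.
Qed.

Lemma cells_measure r n i (th : R) : 100 <= r -> (i < 4 ^ n)%N ->
  angle R n i <= th <= angle R n i.+1 ->
  (((cells R r n i)%:R * (8 * 4 ^+ n)^-1)%:E <=
     lebesgue_measure (proj th @` (sigma r th @` cantorK n)))%E.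
Proof.
move=> r100 iN hth; apply: lebesgue_measure_grid_cells.
- by rewrite invr_gt0 mulr_gt0// exp4_gt0.
- exact: undup_uniq.
by move=> v; rewrite mem_undup => /mapP[m _ ->]; exact: cell_subset_image.
Qed.

(** Induction from the finest ring [J] to coarser ones: indices below [16 * 4 ^ (n - j)] precede
    ring [j] and equal those below [64 * 4 ^ (n - j.+1)]. The condition on [t] keeps [j >= 3]. *)
Lemma cells_sum_ge r n J t : (J < n)%N -> (4 ^ J <= n)%N -> 100 * 4 ^+ J <= r ->
  (t + 3 <= J.+1)%N ->
  t%:R * (48 ^+ 2 * (4 ^+ n) ^+ 2 / (Ccoll R * n%:R)) <=
  \sum_(i < 64 * 4 ^ (n - (J.+1 - t))) (cells R r n i)%:R.
Proof.
move=> Jn J4 rJ; elim: t => [|t ih] tJ; first by rewrite mul0r sumr_ge0.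
have jE : (J.+1 - t.+1 = J - t)%N by rewrite subSS.
have jE' : (J.+1 - t = (J - t).+1)%N by rewrite subSn//; lia.
rewrite jE; set j := (J - t)%N.
have j3n : (3 <= j <= n)%N by rewrite /j; lia.
have jJ : (j <= J)%N by rewrite /j leq_subr.
have j4 : (4 ^ j <= n)%N by rewrite (leq_trans _ J4)// leq_pexp2l.
have rj : 100 * 4 ^+ j <= r.
  by apply: le_trans rJ; rewrite ler_pM2l// ler_eXn2l// ltr1n.
have -> : (64 * 4 ^ (n - j) = 16 * 4 ^ (n - j) + 48 * 4 ^ (n - j))%N by lia.
rewrite big_split_ord/= -natr1 mulrDl mul1r; apply: lerD.
  have -> : (16 * 4 ^ (n - j) = 64 * 4 ^ (n - (J.+1 - t)))%N.
    rewrite jE' -/j; have -> : (n - j = (n - j.+1).+1)%N by lia.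
    by rewrite expnS mulnA.
  by apply: ih; lia.
exact: ring_cells_ge.
Qed.

Lemma Fav_rings_ge r n J : (3 <= J)%N -> (J < n)%N -> (4 ^ J <= n)%N -> 100 * 4 ^+ J <= r ->
  (((2 * pi)^-1 * ((J - 2)%:R * (48 ^+ 2 / (512 * Ccoll R)) / n%:R))%:E <=
    Fav (sigma r) (cantorK n))%E.
Proof.
move=> J3 Jn J4 rJ; have N0 := exp4_gt0 R n; have C0 := Ccoll_gt0 R.
have J1 : 1 <= 4 ^+ J :> R by rewrite exprn_ege1// ler1n.
have r100 : 100 <= r by lra.
have n0 : 0 < n%:R :> R by rewrite ltr0n (leq_ltn_trans _ Jn).
(* Ring 3 ends at [s = 1/64], so rings 3 to [J] lie among the first [4 ^ n] grid angles. *)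
have n3 : (64 * 4 ^ (n - 3) = 4 ^ n)%N by rewrite -[64%N]/(4 ^ 3)%N -expnD subnKC//; lia.
have angleE i : angle R n i = theta0 R + i%:R * (64 * 4 ^+ n)^-1 by [].
have /andP[th0 th1] := theta0_bounds R.
have d0 : 0 < (64 * 4 ^+ n)^-1 :> R by rewrite invr_gt0 mulr_gt0.
have e0 : 0 < (8 * 4 ^+ n)^-1 :> R by rewrite invr_gt0 mulr_gt0.
have aK : theta0 R + (4 ^ n)%:R * (64 * 4 ^+ n)^-1 <= 2 * pi.
  rewrite natrX; have -> : 4 ^+ n * (64 * 4 ^+ n)^-1 = 1 / 64 :> R by field; rewrite gt_eqF.
  by have := pi_ge2 R; lra.
apply: le_trans (Fav_ge (sigma r) (cantorK n) (4 ^ n)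
  (fun i => (cells R r n i)%:R * (8 * 4 ^+ n)^-1) (theta0 R) _ d0 th0 aK _ _); last 2 first.
- by move=> i; rewrite mulr_ge0// ltW.
- by move=> i th iN hth; exact: cells_measure.
have pi0 : 0 < 2 * pi :> R by have := pi_ge2 R; lra.
rewrite lee_fin ler_pM2l ?invr_gt0// -big_distrl/=.
have := cells_sum_ge r n J (J - 2) Jn J4 rJ.
have -> : (J.+1 - (J - 2) = 3)%N by move: J3; clear; lia.
rewrite n3 => hs.
have t3 : (J - 2 + 3 <= J.+1)%N by move: J3; clear; lia.
have := ler_wpM2r (ltW (mulr_gt0 d0 e0)) (hs t3).
set c := \sum_(i < _) _; move: c (Ccoll R) C0 => c C C0.
congr (_ <= _); last by ring.
by field; rewrite !gt_eqF.
Qed.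

Lemma Fav_rings_uniform : exists2 c : R, 0 < c & forall r n J,
  (3 <= J)%N -> (J < n)%N -> (4 ^ J <= n)%N -> 100 * 4 ^+ J <= r ->
  ((c * (J - 2)%:R / n%:R)%:E <= Fav (sigma r) (cantorK n))%E.
Proof.
exists ((2 * pi)^-1 * (48 ^+ 2 / (512 * Ccoll R))).
  have := Ccoll_gt0 R; move: (Ccoll R) => C C0.
  have pi0 := pi_gt0 R.
  apply: mulr_gt0; first by rewrite invr_gt0 mulr_gt0.
  apply: divr_gt0; first by rewrite exprn_gt0.
  by apply: mulr_gt0; rewrite ?ltr0n.
move=> r n J J3 Jn J4 rJ; apply: le_trans (Fav_rings_ge r n J J3 Jn J4 rJ).
rewrite lee_fin; move: (Ccoll R) => C.
by rewrite le_eqVlt; apply/orP; left; apply/eqP; ring.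
Qed.

(** Gives a quadratic lower bound for the radii: [4^x] is the square of [4^(x/2)], and
    [4^(x/2) >= e^(x/2) >= x/2]. *)
Lemma powR4_ge (x : R) : 0 <= x -> (x / 2) ^+ 2 <= 4 `^ x.
Proof.
move=> x0; have e4 : expR 1 <= 4 :> R.
  have h2 : expR (2^-1) <= 2 :> R.
    have := expR_ge1Dx (- 2^-1 : R); rewrite expRN => h.
    rewrite -[leRHS]invrK -[leLHS]invrK lef_pV2 ?posrE ?invr_gt0 ?expR_gt0//.
    lra.
  have -> : expR 1 = expR (2^-1) ^+ 2 :> R by rewrite -expRM_natl divff.
  have := expR_ge0 (2^-1 : R); rewrite expr2; nra.
have -> : 4 `^ x = (4 `^ (x / 2)) ^+ 2 :> R.
  by rewrite -powR_mulrn ?powR_ge0// -powRrM divfK.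
have h : x / 2 <= 4 `^ (x / 2).
  apply: (@le_trans _ _ (expR (x / 2))).
    by apply: le_trans (expR_ge1Dx _); lra.
  rewrite -{1}[x / 2]mul1r expRM; apply: ge0_ler_powR; rewrite ?nnegrE ?expR_ge0//; lra.
by rewrite lerXn2r// nnegrE ?powR_ge0//; lra.
Qed.

End Assembly.

(** * Choice of the threshold, the constant and the number of rings *)

Theorem theorem2 (R : realType) (r : nat -> R) :
  (forall n : nat, (1 <= n)%N -> 4 `^ (n%:R / 5) <= r n) ->
  exists2 C : R, 0 < C &
    forall n : nat, (2 <= n)%N ->
      ((C * ln n%:R / n%:R)%:E <= Fav (sigma (r n)) (cantorK n))%E.
Proof.
move=> hr.
(* For [n >= 10^4] the lower bound [n^2 / 100] on the radius is at least [100 n], and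
   [4 ^ 5 <= n]. *)
have [N0 HN0] : exists N0 : nat, forall n, (N0 <= n)%N -> 100 * 100 <= n%:R :> R.
  by exists (100 * 100)%N => n; rewrite -natrM ler_nat.
have pi0 : 0 < (2 * pi)^-1 :> R by rewrite invr_gt0 mulr_gt0// pi_gt0.
have [c c0 Hc] := Fav_rings_uniform R.
have ln40 : 0 < ln 4 :> R by rewrite ln_gt0// ltr1n.
(* [Cl] serves [n >= N0], through [ln n <= (J + 1) ln 4] and [(J + 1) / 2 <= J - 2] for [J >= 5].
   [Cs] serves [n < N0], where [4 ^- N0 <= 4 ^- n] and [ln n <= n]. *)
pose Cl : R := c / (2 * ln 4).
pose Cs : R := (2 * pi)^-1 * (1 / 4 * (4 ^- N0 / 2)).
have Cl0 : 0 < Cl by rewrite /Cl divr_gt0// mulr_gt0.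
have Cs0 : 0 < Cs by rewrite /Cs !mulr_gt0// ?invr_gt0 ?exp4_gt0.
exists (Num.min Cl Cs); first by rewrite lt_min Cl0 Cs0.
move=> n n2; have n0 : 0 < n%:R :> R by rewrite ltr0n (leq_trans _ n2).
have n1 : (1 <= n)%N by rewrite (leq_trans _ n2).
have lnn0 : 0 <= ln n%:R :> R by rewrite ln_ge0// ler1n.
have pow := hr n n1.
have [nN0|nN0] := ltnP n N0.
  have r1 : 1 <= r n.
    apply: le_trans pow; rewrite -[leLHS](powRr0 4); apply: ler_powR; rewrite ?ler1n// divr_ge0.
  apply: le_trans (Fav_square_ge R (r n) n r1); rewrite lee_fin.
  apply: (@le_trans _ _ Cs).
    rewrite -mulrA -[leRHS]mulr1; apply: ler_pM => //.
    - by rewrite le_min !ltW.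
    - by rewrite divr_ge0// ltW.
    - by rewrite ge_min lexx orbT.
    - by rewrite ler_pdivrMr// mul1r ltW// ln_sublinear.
  rewrite /Cs ler_pM2l// ler_pM2l; last lra.
  by rewrite ler_pM2r// lef_pV2 ?posrE ?exp4_gt0// ler_eXn2l ?ltr1n// ltnW.
have nbig := HN0 n nN0.
have rn : 100 * n%:R <= r n.
  apply: le_trans pow; apply: le_trans (powR4_ge R (n%:R / 5) _); last by rewrite divr_ge0.
  have h : 0 <= n%:R * (n%:R - 100 * 100) :> R by rewrite mulr_ge0//; lra.
  rewrite (_ : (n%:R / 5 / 2) ^+ 2 = n%:R * n%:R / 100 :> R); last by field.
  lra.
(* The last ring index allowed by [4 ^ J <= n]. *)
pose J := trunc_log 4 n.
have J4 : (4 ^ J <= n)%N by apply: trunc_logP.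
have nJ : (n < 4 ^ J.+1)%N by apply: trunc_log_ltn.
have J5 : (5 <= J)%N.
  rewrite -ltnS -(ltn_exp2l _ _ (isT : 1 < 4)%N) (leq_ltn_trans _ nJ)//.
  rewrite -(ler_nat R); apply: le_trans nbig; rewrite natrX; lra.
have Jn : (J < n)%N by rewrite (leq_trans _ J4)// ltn_expl.
have rJ : 100 * 4 ^+ J <= r n.
  by apply: le_trans rn; rewrite ler_pM2l// -natrX ler_nat.
have J3 : (3 <= J)%N by rewrite (leq_trans _ J5).
apply: le_trans (Hc (r n) n J J3 Jn J4 rJ); rewrite lee_fin.
have lnJ : ln n%:R <= J.+1%:R * ln 4 :> R.
  rewrite mulr_natl -lnXn// ler_ln ?posrE ?exp4_gt0//.
  by rewrite -natrX ler_nat ltnW.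
apply: (@le_trans _ _ (Cl * (J.+1%:R * ln 4) / n%:R)).
  rewrite ler_pM2r ?invr_gt0//; apply: ler_pM => //.
    by rewrite le_min !ltW.
  by rewrite ge_min lexx.
rewrite ler_pM2r ?invr_gt0// /Cl.
have -> : c / (2 * ln 4) * (J.+1%:R * ln 4) = c * (J.+1%:R / 2).
  by field; rewrite gt_eqF.
rewrite ler_pM2l// ler_pdivrMr// -natrM ler_nat.
by move: J5; clear; lia.
Qed.
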